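(* Let $\lambda>0$, $0<\phi<\pi$ and let $x\in\mathbb C$ with $\operatorname{Im}x>0$. Then, as $n\to\infty$, $$P_n^{(\lambda)}(x;\phi)\sim\frac{n^{\lambda-ix-1}}{\Gamma(\lambda-ix)}\,e^{in\phi}\,(1-e^{-2i\phi})^{-\lambda-ix},$$ i.e. the ratio of the two sides tends to $1$.
   Context: The Meixner--Pollaczek polynomials are $$P_n^{(\lambda)}(x;\phi)=e^{in\phi}\sum_{k=0}^n\frac{(\lambda+ix)_k(\lambda-ix)_{n-k}}{k!\,(n-k)!}e^{-2ik\phi},$$ with $(\alpha)_0=1$, $(\alpha)_k=\alpha(\alpha+1)\cdots(\alpha+k-1)$. Equivalently, for $|t|<1$, $\sum_{n\ge0}P_n^{(\lambda)}(x;\phi)t^n=(1-te^{i\phi})^{-(\lambda-ix)}(1-te^{-i\phi})^{-(\lambda+ix)}$. Powers are principal branches. *)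

(* Defs.v *)
(* Stdlib reals with Coquelicot's complex numbers. *)
From Stdlib Require Import Reals Factorial Lra.
From Coquelicot Require Import Coquelicot.
Local Open Scope C_scope.

Definition Cexp (z : C) : C :=
  (exp (Re z) * cos (Im z), exp (Re z) * sin (Im z))%R.

(* Principal argument, with values in (-PI, PI]; the value at 0 is junk. *)
Definition Carg (z : C) : R :=
  if Rle_dec 0 (Im z) then acos (Re z / Cmod z) else (- acos (Re z / Cmod z))%R.

Definition Clog (z : C) : C := (ln (Cmod z), Carg z).

(* Principal branch of z^w, for z <> 0. Coquelicot's [Cpow] (notation [^])
   only covers exponents in nat. *)
Definition Cpower (z w : C) : C := Cexp (w * Clog z).

(* Euler's integral, meaningful for Re z > 0. *)
Definition CGamma (z : C) : C :=
  RInt_gen (V := C_R_CompleteNormedModule)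
    (fun t : R => Cpower (RtoC t) (z - 1) * RtoC (exp (- t)))
    (at_right 0) (Rbar_locally p_infty).

Fixpoint Cpoch (a : C) (k : nat) : C :=
  match k with
  | O => 1
  | S j => Cpoch a j * (a + RtoC (INR j))
  end.

(* [sum_n u n] is u 0 + ... + u n. *)
Definition meixner_pollaczek (lambda phi : R) (n : nat) (x : C) : C :=
  Cexp (Ci * INR n * phi) *
  sum_n (G := C_AbelianMonoid)
    (fun k : nat =>
       Cpoch (lambda + Ci * x) k * Cpoch (lambda - Ci * x) (n - k)
       / (INR (fact k) * INR (fact (n - k)))
       * Cexp (- (2 * Ci * INR k * phi))) n.

Lemma Carg_bounds (z : C) : z <> 0 -> (- PI < Carg z <= PI)%R.
Proof.
intros Hz.
assert (Hm := proj1 (Cmod_gt_0 z) Hz).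
assert (B := acos_bound (Re z / Cmod z)).
assert (P := PI_RGT_0).
unfold Carg; destruct (Rle_dec 0 (Im z)) as [H|H]; [lra|].
split; [|lra].
destruct (Req_dec (acos (Re z / Cmod z)) PI) as [E|E]; [|lra].
exfalso.
assert (L := re_le_Cmod z). apply Rabs_le_between in L.
assert (D : (-1 <= Re z / Cmod z <= 1)%R).
{ split; [apply Rle_div_r|apply Rle_div_l]; lra. }
assert (C1 := cos_acos _ D). rewrite E, cos_PI in C1.
assert (R1 : Re z = (- Cmod z)%R).
{ apply (f_equal (fun u => u * Cmod z)%R) in C1. field_simplify in C1; lra. }
assert (M := Cmod2_alt z). rewrite R1 in M. nra.
Qed.

Lemma Cexp_Clog (z : C) : z <> 0 -> Cexp (Clog z) = z.
Proof.
intros Hz.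
assert (Hm := proj1 (Cmod_gt_0 z) Hz).
assert (L := re_le_Cmod z). apply Rabs_le_between in L.
assert (D : (-1 <= Re z / Cmod z <= 1)%R).
{ split; [apply Rle_div_r|apply Rle_div_l]; lra. }
assert (M := Cmod2_alt z).
assert (S : (Cmod z * sqrt (1 - (Re z / Cmod z)²) = Rabs (Im z))%R).
{ rewrite <- (sqrt_Rsqr (Cmod z)) at 1 by lra.
  rewrite <- sqrt_mult_alt by apply Rle_0_sqr.
  rewrite <- sqrt_Rsqr_abs. f_equal.
  unfold Rsqr. field_simplify; lra. }
unfold Cexp, Clog, Carg; simpl. rewrite exp_ln by easy.
rewrite (surjective_pairing z) at 5. unfold Re, Im in *.
destruct (Rle_dec 0 (snd z)) as [H|H]; f_equal;
  rewrite ?cos_neg, ?sin_neg, ?cos_acos, ?sin_acos by easy.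
- field; lra.
- rewrite S, Rabs_pos_eq; lra.
- field; lra.
- rewrite Ropp_mult_distr_r_reverse, S, Rabs_left; lra.
Qed.

(* Main.v *)
(** Write a = lambda - i x, b = lambda + i x and w = e^(-2 i phi), so that |w| = 1,
    w <> 1, Re a > 0 and Re a > Re b.  Up to the factor e^(i n phi) the polynomial
    is the n-th coefficient of (1 - t)^(-a) (1 - w t)^(-b), whose dominant
    singularity is t = 1 because Re a > Re b.  The identity
    1 - w t = (1 - w) + w (1 - t) relates the exponents (a, b), (a, b - 1) and
    (a - 1, b), and so reduces every estimate to very negative exponents, where
    the convolution converges absolutely.  There the partial sums of the binomial
    series at w converge to (1 - w)^(-b) with a rate, and summation by parts turns
    this into the coefficient estimate.  What remains is
    (a)_n / n! ~ n^(a-1) / Gamma(a), which is Gauss's limit for Euler's integral. *)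
Require Import Defs.
From Stdlib Require Import Reals Factorial Lra Lia.
From Coquelicot Require Import Coquelicot.
Local Open Scope C_scope.

(** * Complex exponential, logarithm and powers *)


(** The obstacle is that for large Re b the binomial series of (1 - w t)^(-b) diverges at t = 1, so
    the main term cannot be read off from the convolution at the exponents of the theorem. The
    algebraic relation moves the exponents down one unit at a time; its term (a - 1, b) needs no
    main term of its own, because its whole coefficient already fits into the allowed error. The
    admissible error exponent must be at least Re a - 2 (the next order at t = 1) and Re b - 1 (the
    singularity at t = 1/w), and it can be taken below Re a - 1 because Re a > Re b. All calculus
    takes place along real intervals, with complex values split into real and imaginary parts, and
    every estimate carries an explicit constant. The O(1/n) estimate behind Gauss's limit serves
    three purposes: it yields the convergence of Euler's integral, the nonvanishing of [CGamma] for
    Re a > 0, and the relative error of (a)_n / n!. *)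

Lemma Cexp_plus (u v : C) : Cexp (u + v) = Cexp u * Cexp v.
Proof.
destruct u as [u1 u2], v as [v1 v2]; unfold Cexp, Cmult; simpl.
rewrite exp_plus, cos_plus, sin_plus; f_equal; ring.
Qed.

Lemma Cexp_0 : Cexp 0 = 1.
Proof. unfold Cexp; simpl; rewrite exp_0, cos_0, sin_0; unfold RtoC; f_equal; ring. Qed.

Lemma Cmod_Cexp (z : C) : Cmod (Cexp z) = exp (Re z).
Proof.
unfold Cmod, Cexp; simpl.
transitivity (sqrt (exp (Re z))²); [f_equal|apply sqrt_Rsqr; left; apply exp_pos].
assert (H := sin2_cos2 (Im z)); unfold Rsqr in *.
generalize dependent (cos (Im z)); intros c H; generalize dependent (sin (Im z)); intros s H.
transitivity (exp (Re z) * exp (Re z) * (s * s + c * c))%R; [ring|].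
rewrite H; ring.
Qed.

Lemma Cexp_neq_0 (z : C) : Cexp z <> 0.
Proof. apply Cmod_gt_0; rewrite Cmod_Cexp; apply exp_pos. Qed.

Lemma Cexp_opp (z : C) : Cexp z * Cexp (- z) = 1.
Proof. rewrite <- Cexp_plus, <- Cexp_0; f_equal; ring. Qed.

Lemma Cexp_pow (z : C) (n : nat) : Cexp z ^ n = Cexp (INR n * z).
Proof.
induction n as [|n IH].
- simpl; rewrite <- Cexp_0; f_equal; ring.
- rewrite Cpow_S, IH, <- Cexp_plus, S_INR, RtoC_plus; f_equal; ring.
Qed.

Lemma Cpower_plus (z u v : C) : Cpower z (u + v) = Cpower z u * Cpower z v.
Proof. unfold Cpower; rewrite <- Cexp_plus; f_equal; ring. Qed.

Lemma Cpower_neq_0 (z w : C) : Cpower z w <> 0.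
Proof. apply Cexp_neq_0. Qed.

Lemma Cpower_opp (z w : C) : Cpower z w * Cpower z (- w) = 1.
Proof.
unfold Cpower; rewrite <- (Cexp_opp (w * Clog z)); do 2 f_equal; ring.
Qed.

Lemma Cpower_1 (z : C) : z <> 0 -> Cpower z 1 = z.
Proof. intros Hz; unfold Cpower; rewrite Cmult_1_l; now apply Cexp_Clog. Qed.

Lemma Clog_pos (t : R) : (0 < t)%R -> Clog t = RtoC (ln t).
Proof.
intros Ht; unfold Clog, Carg, RtoC; simpl.
replace (Cmod (t, 0%R)) with t
  by (change (t = Cmod (RtoC t)); rewrite Cmod_R, Rabs_pos_eq; lra).
replace (t / t)%R with 1%R by (field; lra).
rewrite acos_1; destruct (Rle_dec 0 0); [reflexivity|lra].
Qed.

Lemma Cpower_pos (t : R) (w : C) : (0 < t)%R -> Cpower t w = Cexp (w * ln t).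
Proof. intros Ht; unfold Cpower; now rewrite Clog_pos. Qed.

Lemma Cmod_Cpower_pos (t : R) (w : C) :
  (0 < t)%R -> Cmod (Cpower t w) = Rpower t (Re w).
Proof.
intros Ht; rewrite Cpower_pos, Cmod_Cexp by easy.
unfold Rpower; f_equal; destruct w; simpl; ring.
Qed.

(** In the right half-plane the case distinction of [Carg] disappears, which leaves a formula open
    to differentiation. This region suffices: the only bases differentiated below are positive reals
    and 1 - w t with 0 <= t <= 1. *)
Lemma Carg_right (z : C) : (0 < Re z)%R -> Carg z = atan (Im z / Re z).
Proof.
intros Hr.
assert (Hz : z <> 0) by (intros ->; simpl in Hr; lra).
assert (Hm := proj1 (Cmod_gt_0 z) Hz).
assert (L := re_le_Cmod z); apply Rabs_le_between in L.
assert (E := Cexp_Clog z Hz).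
(* This is the interval on which [atan] inverts [tan]; it comes from [acos] of a positive number
   being less than PI / 2. *)
assert (B : (- (PI / 2) < Carg z < PI / 2)%R).
{ assert (D : (0 < Re z / Cmod z <= 1)%R).
  { split; [now apply Rdiv_lt_0_compat|apply Rle_div_l; lra]. }
  assert (A : (acos (Re z / Cmod z) < PI / 2)%R).
  { rewrite acos_atan by apply D; apply atan_bound. }
  assert (A' := acos_bound (Re z / Cmod z)).
  unfold Carg; destruct (Rle_dec 0 (Im z)); lra. }
unfold Cexp, Clog in E; simpl in E; rewrite exp_ln in E by easy.
rewrite <- (atan_tan (Carg z)) by lra.
f_equal; unfold tan.
assert (E1 := f_equal Re E); assert (E2 := f_equal Im E); simpl in E1, E2.
rewrite <- E1, <- E2 at 1.
assert (cos (Carg z) <> 0)%R by (apply Rgt_not_eq, cos_gt_0; lra).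
field; lra.
Qed.

(** Stated by components, so that real tools ([auto_derive], the mean value theorem, the fundamental
    theorem of calculus) apply to each one. *)
Definition is_Cderive (f : R -> C) (t : R) (l : C) : Prop :=
  is_derive (fun s => Re (f s)) t (Re l) /\ is_derive (fun s => Im (f s)) t (Im l).

Lemma is_Cderive_eq (f : R -> C) (t : R) (l l' : C) :
  is_Cderive f t l -> l = l' -> is_Cderive f t l'.
Proof. now intros H <-. Qed.

Lemma is_Cderive_ext_loc (f g : R -> C) (t : R) (l : C) :
  locally t (fun s => f s = g s) -> is_Cderive f t l -> is_Cderive g t l.
Proof.
intros H [H1 H2]; split.
- apply is_derive_ext_loc with (2 := H1).
  revert H; apply filter_imp; now intros s ->.
- apply is_derive_ext_loc with (2 := H2).
  revert H; apply filter_imp; now intros s ->.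
Qed.

Lemma is_Cderive_const (c : C) (t : R) : is_Cderive (fun _ => c) t 0.
Proof. split; apply (is_derive_const (V := R_NormedModule)). Qed.

Lemma is_Cderive_RtoC (f : R -> R) (t l : R) :
  is_derive f t l -> is_Cderive (fun s => RtoC (f s)) t l.
Proof.
intros H; split; simpl; [exact H|apply (is_derive_const (V := R_NormedModule))].
Qed.

Lemma is_Cderive_plus (f g : R -> C) (t : R) (l m : C) :
  is_Cderive f t l -> is_Cderive g t m -> is_Cderive (fun s => f s + g s) t (l + m).
Proof.
intros [F1 F2] [G1 G2]; split; simpl.
- now apply (is_derive_plus (V := R_NormedModule)).
- now apply (is_derive_plus (V := R_NormedModule)).
Qed.

Lemma is_Cderive_mult (f g : R -> C) (t : R) (l m : C) :
  is_Cderive f t l -> is_Cderive g t m ->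
  is_Cderive (fun s => f s * g s) t (l * g t + f t * m).
Proof.
assert (A : forall (u1 u2 v1 v2 : R -> R) (a b c d : R),
  is_derive u1 t a -> is_derive u2 t b -> is_derive v1 t c -> is_derive v2 t d ->
  is_derive (fun s => u1 s * v1 s - u2 s * v2 s)%R t
    (a * v1 t + u1 t * c - (b * v2 t + u2 t * d))%R /\
  is_derive (fun s => u1 s * v2 s + u2 s * v1 s)%R t
    (a * v2 t + u1 t * d + (b * v1 t + u2 t * c))%R).
{ intros u1 u2 v1 v2 a b c d F1 F2 G1 G2.
  assert (D1 : Derive (fun s => u1 s) t = a) by exact (is_derive_unique _ _ _ F1).
  assert (D2 : Derive (fun s => u2 s) t = b) by exact (is_derive_unique _ _ _ F2).
  assert (D3 : Derive (fun s => v1 s) t = c) by exact (is_derive_unique _ _ _ G1).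
  assert (D4 : Derive (fun s => v2 s) t = d) by exact (is_derive_unique _ _ _ G2).
  split; (auto_derive; [repeat split; eexists; eassumption|]);
    rewrite D1, D2, D3, D4; ring. }
intros [F1 F2] [G1 G2]; destruct (A _ _ _ _ _ _ _ _ F1 F2 G1 G2) as [A1 A2].
split; [evar_last; [exact A1|]|evar_last; [exact A2|]]; unfold Re, Im; simpl; ring.
Qed.

Lemma is_Cderive_scal (c : C) (f : R -> C) (t : R) (l : C) :
  is_Cderive f t l -> is_Cderive (fun s => c * f s) t (c * l).
Proof.
intros H; eapply is_Cderive_eq.
- apply is_Cderive_mult; [apply is_Cderive_const|exact H].
- cbv beta; ring.
Qed.

Lemma is_Cderive_Cexp (f : R -> C) (t : R) (l : C) :
  is_Cderive f t l -> is_Cderive (fun s => Cexp (f s)) t (l * Cexp (f t)).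
Proof.
assert (A : forall (u v : R -> R) (a b : R), is_derive u t a -> is_derive v t b ->
  is_derive (fun s => exp (u s) * cos (v s))%R t
    (a * (exp (u t) * cos (v t)) - b * (exp (u t) * sin (v t)))%R /\
  is_derive (fun s => exp (u s) * sin (v s))%R t
    (a * (exp (u t) * sin (v t)) + b * (exp (u t) * cos (v t)))%R).
{ intros u v a b F1 F2.
  assert (D1 : Derive (fun s => u s) t = a) by exact (is_derive_unique _ _ _ F1).
  assert (D2 : Derive (fun s => v s) t = b) by exact (is_derive_unique _ _ _ F2).
  split; (auto_derive; [repeat split; eexists; eassumption|]); rewrite D1, D2; ring. }
intros [F1 F2]; destruct (A _ _ _ _ F1 F2) as [A1 A2].
split; [evar_last; [exact A1|]|evar_last; [exact A2|]]; unfold Cexp, Re, Im; simpl; ring.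
Qed.

Lemma is_Cderive_Clog (f : R -> C) (t : R) (l : C) :
  (0 < Re (f t))%R -> is_Cderive f t l ->
  is_Cderive (fun s => Clog (f s)) t (l / f t).
Proof.
assert (A : forall (u v : R -> R) (a b : R), (0 < u t)%R ->
  is_derive u t a -> is_derive v t b ->
  is_derive (fun s => ln (sqrt (u s ^ 2 + v s ^ 2)))%R t
    ((a * u t + b * v t) / (u t ^ 2 + v t ^ 2))%R /\
  is_derive (fun s => atan (v s / u s))%R t
    ((b * u t - a * v t) / (u t ^ 2 + v t ^ 2))%R).
{ intros u v a b Hp F1 F2.
  assert (D1 : Derive (fun s => u s) t = a) by exact (is_derive_unique _ _ _ F1).
  assert (D2 : Derive (fun s => v s) t = b) by exact (is_derive_unique _ _ _ F2).
  assert (P : (0 < u t ^ 2 + v t ^ 2)%R) by nra.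
  split; auto_derive.
  - repeat split; try (eexists; eassumption); [simpl in P; lra|].
    apply sqrt_lt_R0; simpl in P; lra.
  - rewrite D1, D2; set (q := (u t ^ 2 + v t ^ 2)%R) in *.
    replace (u t * (u t * 1) + v t * (v t * 1))%R with q by (unfold q; ring).
    assert (Q : (sqrt q * sqrt q = q)%R) by (apply sqrt_sqrt; lra).
    assert (Q' := sqrt_lt_R0 q P).
    clearbody q; generalize dependent (sqrt q); intros r Q Q'; subst q. field; lra.
  - repeat split; try (eexists; eassumption); lra.
  - rewrite D1, D2; unfold Rsqr; field; split; nra. }
intros Hp [F1 F2].
assert (L : locally t (fun s => (0 < Re (f s))%R)).
{ assert (Cf : continuous (fun s => Re (f s)) t)
    by (apply (ex_derive_continuous (V := R_NormedModule)); eexists; exact F1).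
  apply Cf; now apply (open_gt 0%R). }
assert (P : (0 < Re (f t) ^ 2 + Im (f t) ^ 2)%R) by nra.
destruct (A _ _ _ _ Hp F1 F2) as [A1 A2].
split; evar_last.
- exact A1.
- unfold Re, Im in *; simpl in *; field; nra.
- refine (is_derive_ext_loc _ _ _ _ _ A2).
  revert L; apply filter_imp; intros s Hs; simpl; now rewrite Carg_right.
- unfold Re, Im in *; simpl in *; field; nra.
Qed.

Lemma is_Cderive_Cpower (f : R -> C) (t : R) (l w : C) :
  (0 < Re (f t))%R -> is_Cderive f t l ->
  is_Cderive (fun s => Cpower (f s) w) t (w * l / f t * Cpower (f t) w).
Proof.
intros Hp H; unfold Cpower; eapply is_Cderive_eq.
- apply is_Cderive_Cexp, is_Cderive_scal, is_Cderive_Clog; eassumption.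
- unfold Cdiv; ring.
Qed.

Lemma is_Cderive_continuous (f : R -> C) (t : R) (l : C) :
  is_Cderive f t l ->
  continuous (U := C_R_NormedModule) f t.
Proof.
intros [F1 F2].
apply continuous_ext with (fun s => (Re (f s), Im (f s))).
{ intros s; now destruct (f s). }
apply continuous_comp_2 with (h := fun u v : R => (u, v)).
- apply (ex_derive_continuous (V := R_NormedModule)); eexists; exact F1.
- apply (ex_derive_continuous (V := R_NormedModule)); eexists; exact F2.
- intros P [eps HP]; exists eps; intros [a b] [H1 H2]; apply HP; split; assumption.
Qed.

Lemma is_RInt_Cderive (f df : R -> C) (a b : R) :
  (forall t, Rmin a b <= t <= Rmax a b -> is_Cderive f t (df t)) ->
  (forall t, Rmin a b <= t <= Rmax a b -> continuous (U := C_R_NormedModule) df t) ->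
  is_RInt (V := C_R_NormedModule) df a b (f b - f a).
Proof.
intros H K.
replace (f b - f a) with ((Re (f b) - Re (f a))%R, (Im (f b) - Im (f a))%R)
  by (apply injective_projections; unfold Re, Im; simpl; ring).
apply is_RInt_fct_extend_pair.
- apply (is_RInt_derive (V := R_CompleteNormedModule) (fun t => Re (f t))).
  + intros t Ht; apply (H t Ht).
  + intros t Ht; apply (continuous_comp df fst); [now apply K|apply continuous_fst].
- apply (is_RInt_derive (V := R_CompleteNormedModule) (fun t => Im (f t))).
  + intros t Ht; apply (H t Ht).
  + intros t Ht; apply (continuous_comp df snd); [now apply K|apply continuous_snd].
Qed.

Lemma Cmod_le_Re_Im (z : C) : (Cmod z <= Rabs (Re z) + Rabs (Im z))%R.
Proof.
assert (H := Cmod2_alt z). assert (H0 := Cmod_ge_0 z).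
assert (A := Rabs_pos (Re z)); assert (B := Rabs_pos (Im z)).
rewrite <- (pow2_abs (Re z)), <- (pow2_abs (Im z)) in H.
apply Rsqr_incr_0; unfold Rsqr; nra.
Qed.

Lemma im_le_Cmod (z : C) : (Rabs (Im z) <= Cmod z)%R.
Proof.
apply Rle_trans with (2 := Rmax_Cmod z); apply Rmax_r.
Qed.

(** The mean value theorem fails for complex values, so it is applied to the real and imaginary
    parts separately; their intermediate points differ, whence the factor 2. *)
Lemma Cmod_increment_le (f df : R -> C) (M : R) :
  (forall t, 0 <= t <= 1 -> is_Cderive f t (df t))%R ->
  (forall t, 0 <= t <= 1 -> Cmod (df t) <= M)%R ->
  (Cmod (f 1%R - f 0%R) <= 2 * M)%R.
Proof.
intros H HM.
assert (E : Rmin 0 1 = 0%R /\ Rmax 0 1 = 1%R)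
  by (split; [apply Rmin_left|apply Rmax_right]; lra).
destruct (MVT_gen (fun t => Re (f t)) 0 1 (fun t => Re (df t))) as [c [Hc Ec]];
  rewrite ?(proj1 E), ?(proj2 E) in *.
{ intros t Ht; apply (H t); lra. }
{ intros t Ht; apply continuity_pt_filterlim, (ex_derive_continuous (V := R_NormedModule)).
  eexists; apply (H t); lra. }
destruct (MVT_gen (fun t => Im (f t)) 0 1 (fun t => Im (df t))) as [d [Hd Ed]];
  rewrite ?(proj1 E), ?(proj2 E) in *.
{ intros t Ht; apply (H t); lra. }
{ intros t Ht; apply continuity_pt_filterlim, (ex_derive_continuous (V := R_NormedModule)).
  eexists; apply (H t); lra. }
apply Rle_trans with (1 := Cmod_le_Re_Im _).
replace (Re (f 1%R - f 0%R)) with (Re (df c)) by (unfold Re, Im in *; simpl; lra).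
replace (Im (f 1%R - f 0%R)) with (Im (df d)) by (unfold Re, Im in *; simpl; lra).
assert (H1 := re_le_Cmod (df c)); assert (H2 := im_le_Cmod (df d)).
assert (H3 := HM c Hc); assert (H4 := HM d Hd); lra.
Qed.

(** * Power bounds for sequences and convolutions *)


(** The shift by one keeps the base at least 1, so the bound makes sense from index 0 on and weakens
    as the exponent grows. *)
Definition bigO_pow (u : nat -> C) (s : R) : Prop :=
  exists K : R, forall n : nat, (Cmod (u n) <= K * Rpower (INR n + 1) s)%R.

(** The Taylor coefficient of t^k in (1 - t)^(-a). *)
Definition binom (a : C) (k : nat) : C := Cpoch a k / INR (fact k).

Definition conv (u v : nat -> C) (n : nat) : C :=
  sum_n (G := C_AbelianMonoid) (fun k => u k * v (n - k)%nat) n.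

Lemma INR_S_neq_0 (n : nat) : RtoC (INR n) + 1 <> 0.
Proof.
intros H; apply (f_equal Re) in H; simpl in H; assert (P := pos_INR n); lra.
Qed.

Lemma INR_fact_C_neq_0 (n : nat) : RtoC (INR (fact n)) <> 0.
Proof.
intros H; apply (f_equal Re) in H; simpl in H; now apply (INR_fact_neq_0 n).
Qed.

Lemma binom_0 (a : C) : binom a 0 = 1.
Proof. unfold binom; simpl; field; apply RtoC_neq; lra. Qed.

Lemma binom_S (a : C) (k : nat) :
  binom a (S k) = binom a k * (a + INR k) / (INR k + 1).
Proof.
unfold binom; simpl Cpoch.
rewrite fact_simpl, mult_INR, RtoC_mult, S_INR, RtoC_plus.
field; split; [apply INR_fact_C_neq_0|apply INR_S_neq_0].
Qed.

(** Coefficient form of (1 - t)^(-(a - 1)) = (1 - t) (1 - t)^(-a). *)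
Lemma binom_pred (a : C) (k : nat) : binom (a - 1) (S k) = binom a (S k) - binom a k.
Proof.
induction k as [|k IH].
- rewrite !binom_S, !binom_0; simpl; field; apply RtoC_neq; lra.
- rewrite (binom_S (a - 1)), IH, (binom_S a (S k)), (binom_S a k), S_INR, RtoC_plus.
  field; split; [apply INR_S_neq_0|].
  rewrite <- (RtoC_plus (INR k) 1), <- S_INR; exact (INR_S_neq_0 (S k)).
Qed.

Lemma sum_n_C_S (u : nat -> C) (n : nat) :
  sum_n (G := C_AbelianMonoid) u (S n) = sum_n (G := C_AbelianMonoid) u n + u (S n).
Proof. exact (sum_Sn u n). Qed.

Lemma sum_n_C_scal (c : C) (u : nat -> C) (n : nat) :
  sum_n (G := C_AbelianMonoid) (fun k => c * u k) n = c * sum_n (G := C_AbelianMonoid) u n.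
Proof.
induction n as [|n IH]; [now rewrite !sum_O|].
rewrite !sum_n_C_S, IH; simpl; ring.
Qed.

Lemma sum_n_C_minus (u v : nat -> C) (n : nat) :
  sum_n (G := C_AbelianMonoid) (fun k => u k - v k) n
  = sum_n (G := C_AbelianMonoid) u n - sum_n (G := C_AbelianMonoid) v n.
Proof.
induction n as [|n IH]; [now rewrite !sum_O|].
rewrite !sum_n_C_S, IH; simpl; ring.
Qed.

Lemma sum_n_shift {G : AbelianMonoid} (u : nat -> G) (n : nat) :
  sum_n u (S n) = plus (u O) (sum_n (fun k => u (S k)) n).
Proof.
induction n as [|n IH]; [now rewrite sum_Sn, !sum_O|].
now rewrite sum_Sn, IH, sum_Sn, plus_assoc.
Qed.

Lemma sum_n_rev {G : AbelianMonoid} (u : nat -> G) (n : nat) :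
  sum_n (fun k => u (n - k)%nat) n = sum_n u n.
Proof.
induction n as [|n IH]; [now rewrite !sum_O|].
rewrite sum_n_shift, Nat.sub_0_r, sum_Sn, plus_comm; f_equal.
exact IH.
Qed.

Lemma conv_comm (u v : nat -> C) (n : nat) : conv u v n = conv v u n.
Proof.
unfold conv; rewrite <- sum_n_rev; apply sum_n_ext_loc; intros k Hk; simpl.
replace (n - (n - k))%nat with k by lia; ring.
Qed.

(** The hypotheses say that the generating function of [u'] is 1 - w t times that of [u]; the factor
    passes to the product with [v]. *)
Lemma conv_shift (u u' v : nat -> C) (w : C) (n : nat) :
  u' O = u O -> (forall k, u' (S k) = u (S k) - w * u k) ->
  conv u' v (S n) = conv u v (S n) - w * conv u v n.
Proof.
intros H0 HS; unfold conv; rewrite !sum_n_shift, H0.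
rewrite (sum_n_ext (fun k => u' (S k) * v (S n - S k)%nat)
          (fun k => u (S k) * v (S n - S k)%nat - w * (u k * v (n - k)%nat))).
2: { intros k; rewrite HS; simpl; ring. }
rewrite sum_n_C_minus, sum_n_C_scal; unfold plus; simpl; ring.
Qed.

Lemma Cmod_conv_le (u v : nat -> C) (n : nat) :
  (Cmod (conv u v n) <= sum_n (fun k => Cmod (u k) * Cmod (v (n - k)%nat)) n)%R.
Proof.
unfold conv.
(* Separates the [n] inside [n - k] from the length of the sum, so that the induction changes only
   the latter. *)
generalize n at 1 3 as m; intros m.
generalize (fun k => v (m - k)%nat); intros v'.
induction n as [|n IH]; [rewrite !sum_O, Cmod_mult; apply Rle_refl|].
rewrite !sum_Sn; unfold plus; simpl.
apply Rle_trans with (1 := Cmod_triangle _ _).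
rewrite Cmod_mult; lra.
Qed.

Lemma INR_1_pos (n : nat) : (0 < INR n + 1)%R.
Proof. assert (H := pos_INR n); lra. Qed.

Lemma Rpower_pos (x s : R) : (0 < Rpower x s)%R.
Proof. apply exp_pos. Qed.

Lemma bigO_pow_nonneg (u : nat -> C) (s : R) :
  bigO_pow u s ->
  exists K : R, (0 <= K)%R /\ forall n : nat, (Cmod (u n) <= K * Rpower (INR n + 1) s)%R.
Proof.
intros [K H]; exists K; split; [|exact H].
assert (H0 := H O); assert (P := Cmod_ge_0 (u O)); assert (Q := Rpower_pos (INR 0 + 1) s).
nra.
Qed.

Lemma bigO_pow_ext (u v : nat -> C) (s : R) :
  (forall n, u n = v n) -> bigO_pow u s -> bigO_pow v s.
Proof. intros E [K H]; exists K; intros n; now rewrite <- E. Qed.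

Lemma bigO_pow_weaken (u : nat -> C) (s s' : R) :
  (s <= s')%R -> bigO_pow u s -> bigO_pow u s'.
Proof.
intros Hs H; destruct (bigO_pow_nonneg _ _ H) as [K [K0 HK]]; exists K; intros n.
apply Rle_trans with (1 := HK n); apply Rmult_le_compat_l; [easy|].
apply Rle_Rpower; [assert (P := pos_INR n); lra|easy].
Qed.

Lemma bigO_pow_scal (c : C) (u : nat -> C) (s : R) :
  bigO_pow u s -> bigO_pow (fun n => c * u n) s.
Proof.
intros [K H]; exists (Cmod c * K)%R; intros n; rewrite Cmod_mult, Rmult_assoc.
apply Rmult_le_compat_l; [apply Cmod_ge_0|apply H].
Qed.

Lemma bigO_pow_minus (u v : nat -> C) (s : R) :
  bigO_pow u s -> bigO_pow v s -> bigO_pow (fun n => u n - v n) s.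
Proof.
intros [K H] [L M]; exists (K + L)%R; intros n.
apply Rle_trans with (1 := Cmod_triangle _ _); rewrite Cmod_opp, Rmult_plus_distr_r.
apply Rplus_le_compat; auto.
Qed.

(** The subtracted term makes the induction close: with x = n the gain of one step is 1 / ((x + 1)
    (x + 2)^2) > 0. *)
Lemma sum_inv_squares_le (n : nat) :
  (sum_n (fun k => Rpower (INR k + 1) (-2)) n <= 2 - / (INR n + 1))%R.
Proof.
assert (E : forall k, Rpower (INR k + 1) (-2) = (/ (INR k + 1) ^ 2)%R).
{ intros k; replace (-2)%R with (- INR 2)%R by (simpl; ring).
  rewrite Rpower_Ropp, Rpower_pow; [easy|apply INR_1_pos]. }
induction n as [|n IH].
- rewrite sum_O, E; simpl; lra.
- rewrite sum_Sn, E; unfold plus; simpl plus; cbv beta.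
  apply Rle_trans with (2 - / (INR n + 1) + / (INR (S n) + 1) ^ 2)%R;
    [now apply Rplus_le_compat_r|].
  rewrite S_INR; assert (P := pos_INR n); set (x := INR n) in *.
  apply Rminus_le_0.
  replace (_ - _)%R with (/ ((x + 1) * (x + 1 + 1) ^ 2))%R by (field; lra).
  left; apply Rinv_0_lt_compat; nra.
Qed.

(** For s >= 0 this is monotonicity; for s < 0 it follows from n + 1 <= (k + 1) (n - k + 1). Thus
    replacing n - k by n costs only a power of k + 1. *)
Lemma Rpower_split_le (n k : nat) (s : R) :
  (k <= n)%nat ->
  (Rpower (INR (n - k) + 1) s
   <= Rpower (INR k + 1) (Rmax 0 (- s)) * Rpower (INR n + 1) s)%R.
Proof.
intros Hk; rewrite minus_INR by easy.
assert (P := pos_INR k); assert (Q := le_INR _ _ Hk).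
set (x := INR k) in *; set (y := INR n) in *.
destruct (Rle_dec 0 s) as [Hs|Hs].
- rewrite Rmax_left, Rpower_O by lra; rewrite Rmult_1_l.
  apply Rle_Rpower_l; lra.
- rewrite Rmax_right by lra.
  rewrite <- (Ropp_involutive s) at 1 3; rewrite (Rpower_Ropp (y - x + 1)), (Rpower_Ropp (y + 1)).
  assert (H1 := Rpower_pos (y + 1) (- s)); assert (H2 := Rpower_pos (y - x + 1) (- s)).
  apply Rmult_le_reg_r with (1 := H1); apply Rmult_le_reg_r with (1 := H2).
  field_simplify; [|lra|lra].
  rewrite Rmult_comm, Rpower_mult_distr by lra.
  apply Rle_Rpower_l; [lra|split; [lra|nra]].
Qed.

Lemma sum_n_le_loc (f g : nat -> R) (n : nat) :
  (forall k, (k <= n)%nat -> (f k <= g k)%R) -> (sum_n f n <= sum_n g n)%R.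
Proof.
induction n as [|n IH]; intros T; [rewrite !sum_O; apply T; lia|].
rewrite !sum_Sn; apply Rplus_le_compat; [apply IH; intros; apply T; lia|apply T; lia].
Qed.

(** The decay of [u] absorbs the cost (k + 1)^max(0, -s) of replacing n - k by n in the bound for
    [v], and still leaves the summable factor (k + 1)^(-2). *)
Lemma bigO_pow_conv (u v : nat -> C) (p s : R) :
  (p <= - 2 - Rmax 0 (- s))%R -> bigO_pow u p -> bigO_pow v s -> bigO_pow (conv u v) s.
Proof.
intros Hp Hu Hv.
destruct (bigO_pow_nonneg _ _ Hu) as [K [K0 HK]].
destruct (bigO_pow_nonneg _ _ Hv) as [L [L0 HL]].
exists (K * L * 2)%R; intros n.
apply Rle_trans with (1 := Cmod_conv_le u v n).
apply Rle_trans with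
  (sum_n (fun k => (K * L * Rpower (INR n + 1) s) * Rpower (INR k + 1) (-2))%R n).
- assert (T : forall k, (k <= n)%nat ->
    (Cmod (u k) * Cmod (v (n - k)%nat)
     <= K * L * Rpower (INR n + 1) s * Rpower (INR k + 1) (-2))%R).
  { intros k Hk.
    apply Rle_trans with
      ((K * Rpower (INR k + 1) p) * (L * (Rpower (INR k + 1) (Rmax 0 (- s)) * Rpower (INR n + 1) s)))%R.
    - apply Rmult_le_compat; try apply Cmod_ge_0; [apply HK|].
      apply Rle_trans with (1 := HL _); apply Rmult_le_compat_l; [easy|].
      now apply Rpower_split_le.
    - replace (K * Rpower (INR k + 1) p * (L * (Rpower (INR k + 1) (Rmax 0 (- s)) * Rpower (INR n + 1) s)))%R
        with ((K * L * Rpower (INR n + 1) s) * (Rpower (INR k + 1) p * Rpower (INR k + 1) (Rmax 0 (- s))))%R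
        by ring.
      rewrite <- Rpower_plus; apply Rmult_le_compat_l.
      + assert (H := Rpower_pos (INR n + 1) s); apply Rmult_le_pos; [|lra]; now apply Rmult_le_pos.
      + apply Rle_Rpower; [assert (P := pos_INR k); lra|lra]. }
  now apply sum_n_le_loc.
- assert (E := sum_n_mult_l (K := R_Ring) (K * L * Rpower (INR n + 1) s)%R
            (fun k => Rpower (INR k + 1) (-2)) n).
  eapply Rle_trans; [right; exact E|].
  change (K * L * Rpower (INR n + 1) s * sum_n (fun k => Rpower (INR k + 1) (-2)) n
    <= K * L * 2 * Rpower (INR n + 1) s)%R.
  assert (H := sum_inv_squares_le n).
  assert (H1 : (0 < / (INR n + 1))%R) by apply Rinv_0_lt_compat, INR_1_pos.
  assert (H2 := Rpower_pos (INR n + 1) s).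
  assert (0 <= K * L * Rpower (INR n + 1) s)%R
    by (apply Rmult_le_pos; [|lra]; now apply Rmult_le_pos).
  replace (K * L * 2 * Rpower (INR n + 1) s)%R with (K * L * Rpower (INR n + 1) s * 2)%R by ring.
  apply Rmult_le_compat_l; lra.
Qed.

(** * Binomial coefficients *)


Lemma ln_le_minus_1 (x : R) : (0 < x)%R -> (ln x <= x - 1)%R.
Proof.
intros Hx; assert (H := exp_ineq1_le (ln x)); rewrite exp_ln in H by easy; lra.
Qed.

Lemma ln_succ_bounds (m : R) :
  (0 < m)%R -> (/ (m + 1) <= ln (m + 1) - ln m <= / m)%R.
Proof.
intros Hm; split.
- assert (H := ln_le_minus_1 (m / (m + 1))); rewrite ln_div in H by lra.
  replace (m / (m + 1) - 1)%R with (- / (m + 1))%R in H by (field; lra).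
  assert (0 < m / (m + 1))%R by (apply Rdiv_lt_0_compat; lra); lra.
- rewrite <- ln_div by lra.
  apply Rle_trans with (1 := ln_le_minus_1 ((m + 1) / m) ltac:(apply Rdiv_lt_0_compat; lra)).
  right; field; lra.
Qed.

Lemma exp_le_compat (x y : R) : (x <= y)%R -> (exp x <= exp y)%R.
Proof. intros [H| ->]; [left; now apply exp_increasing|apply Rle_refl]. Qed.

(** With m = n + 1, the ratio of consecutive squared moduli is 1 + 2 s / m + d / m^2 <= exp (2 s / m
    + d / m^2). The sum of the 2 s / m is compared with 2 s ln m, and the O(1/m^2) defects are
    absorbed by the telescoping term 2 K (1 - 1 / (n + 1)), since 1 / m^2 <= 2 (1 / m - 1 / (m +
    1)). *)
Lemma binom_bigO (a : C) : bigO_pow (binom a) (Re a - 1).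
Proof.
set (s := (Re a - 1)%R); set (d := (s ^ 2 + Im a ^ 2)%R).
(* [d] pays for d / m^2, and 2 |s| for exchanging 2 s / m with 2 s (ln (m + 1) - ln m), at a cost of
   at most 2 |s| / m^2. *)
set (K := (d + 2 * Rabs s)%R).
assert (Hd : (0 <= d)%R) by (unfold d; nra).
assert (HK : (0 <= K)%R) by (unfold K; assert (P := Rabs_pos s); lra).
assert (I : forall n, (Cmod (binom a n) ^ 2
   <= exp (2 * K * (1 - / (INR n + 1)) + 2 * (s * ln (INR n + 1))))%R).
{ induction n as [|n IH].
  - rewrite binom_0, Cmod_1; simpl; rewrite Rplus_0_l, ln_1.
    replace (_ + _)%R with 0%R by field; rewrite exp_0; lra.
  - rewrite binom_S; unfold Cdiv; rewrite !Cmod_mult, Cmod_inv by apply INR_S_neq_0.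
    rewrite S_INR; assert (P := INR_1_pos n).
    replace (RtoC (INR n) + 1) with (RtoC (INR n + 1)) by apply RtoC_plus.
    rewrite Cmod_R, Rabs_pos_eq by lra.
    rewrite !Rpow_mult_distr, (Cmod2_alt (a + INR n)).
    replace (Re (a + INR n)) with (s + (INR n + 1))%R by (unfold s, Re; simpl; ring).
    replace (Im (a + INR n)) with (Im a) by (unfold Im; simpl; ring).
    set (m := (INR n + 1)%R) in *.
    assert (Hm : (1 <= m)%R) by (unfold m; assert (Q := pos_INR n); lra).
    apply Rle_trans with
      (exp (2 * K * (1 - / m) + 2 * (s * ln m)) * exp (2 * s / m + d / m ^ 2))%R.
    + replace (Cmod (binom a n) ^ 2 * ((s + m) ^ 2 + Im a ^ 2) * (/ m) ^ 2)%R
        with (Cmod (binom a n) ^ 2 * (1 + (2 * s / m + d / m ^ 2)))%R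
        by (unfold d; field; lra).
      apply Rmult_le_compat; [apply pow2_ge_0| |exact IH|apply exp_ineq1_le].
      replace (1 + (2 * s / m + d / m ^ 2))%R with (((s + m) ^ 2 + Im a ^ 2) / m ^ 2)%R
        by (unfold d; field; lra).
      apply Rmult_le_pos; [apply Rplus_le_le_0_compat; apply pow2_ge_0|].
      left; apply Rinv_0_lt_compat, pow_lt; lra.
    + rewrite <- exp_plus; apply exp_le_compat.
      assert (L := ln_succ_bounds m ltac:(lra)).
      assert (S1 : (/ m - / (m + 1) <= / m ^ 2)%R).
      { apply Rminus_le_0; replace (_ - _)%R with (/ (m ^ 2 * (m + 1)))%R by (field; lra).
        left; apply Rinv_0_lt_compat, Rmult_lt_0_compat; [apply pow_lt|]; lra. }
      assert (S2 : (/ m ^ 2 <= 2 * (/ m - / (m + 1)))%R).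
      { apply Rminus_le_0; replace (_ - _)%R with ((m - 1) * / (m ^ 2 * (m + 1)))%R by (field; lra).
        apply Rmult_le_pos; [lra|left; apply Rinv_0_lt_compat; nra]. }
      set (e := (/ m - (ln (m + 1) - ln m))%R).
      assert (E : (s * e <= Rabs s * / m ^ 2)%R).
      { apply Rle_trans with (Rabs (s * e)); [apply Rle_abs|].
        rewrite Rabs_mult; apply Rmult_le_compat_l; [apply Rabs_pos|].
        unfold e; rewrite Rabs_pos_eq; lra. }
      assert (F : (K * / m ^ 2 <= K * (2 * (/ m - / (m + 1))))%R)
        by (apply Rmult_le_compat_l; lra).
      unfold K in F at 1; unfold e in E; unfold Rdiv; lra. }
exists (exp K); intros n.
apply Rsqr_incr_0; [|apply Cmod_ge_0|left; apply Rmult_lt_0_compat; apply exp_pos].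
rewrite !Rsqr_pow2; apply Rle_trans with (1 := I n).
unfold Rpower; rewrite <- exp_plus, <- Rsqr_pow2; unfold Rsqr; rewrite <- exp_plus.
apply exp_le_compat.
assert (0 < / (INR n + 1))%R by apply Rinv_0_lt_compat, INR_1_pos; nra.
Qed.

(* Coefficients of (1 - w t)^(-b). *)
Definition binomw (w b : C) (k : nat) : C := binom b k * w ^ k.

Lemma binomw_bigO (w b : C) : Cmod w = 1%R -> bigO_pow (binomw w b) (Re b - 1).
Proof.
intros Hw; destruct (binom_bigO b) as [K H]; exists K; intros n.
unfold binomw; rewrite Cmod_mult, Cmod_pow, Hw, pow1, Rmult_1_r; apply H.
Qed.

(* Comparison of coefficients in 1 - w t = (1 - w) + w (1 - t), multiplied by
   (1 - t)^(-a) (1 - w t)^(-b). *)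
Lemma conv_contiguous (a b w : C) (n : nat) :
  (1 - w) * conv (binomw w b) (binom a) n
  = conv (binomw w (b - 1)) (binom a) n - w * conv (binomw w b) (binom (a - 1)) n.
Proof.
destruct n as [|n].
- unfold conv, binomw; rewrite !sum_O, !binom_0; simpl; ring.
- rewrite (conv_shift (binomw w b) (binomw w (b - 1)) (binom a) w),
    (conv_comm (binomw w b) (binom (a - 1))),
    (conv_shift (binom a) (binom (a - 1)) (binomw w b) 1), !(conv_comm (binom a)).
  + ring.
  + now rewrite !binom_0.
  + intros k; rewrite binom_pred; ring.
  + unfold binomw; now rewrite !binom_0.
  + intros k; unfold binomw; rewrite binom_pred, Cpow_S; ring.
Qed.

Lemma bigO_pow_contiguous (w : C) (u v x : nat -> C) (s : R) :
  1 - w <> 0 -> (forall n, (1 - w) * u n = v n - w * x n) ->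
  bigO_pow v s -> bigO_pow x s -> bigO_pow u s.
Proof.
intros Hw E Hv Hx.
apply bigO_pow_ext with (fun n => / (1 - w) * (v n - w * x n)).
- intros n; rewrite <- E; now field.
- now apply bigO_pow_scal, bigO_pow_minus; [|apply bigO_pow_scal].
Qed.

(** Both terms on the right of [conv_contiguous] have Re a + Re b smaller by one and keep the two
    upper bounds, so induction on that sum applies until one factor decays fast enough for
    [bigO_pow_conv]. *)
Lemma conv_binom_bigO (w a b : C) (s : R) :
  Cmod w = 1%R -> 1 - w <> 0 -> (Re a - 1 <= s)%R -> (Re b - 1 <= s)%R ->
  bigO_pow (conv (binomw w b) (binom a)) s.
Proof.
intros Hw Hw1.
(* An exponent with real part at most [mu] gives coefficients of order exactly within the threshold
   of [bigO_pow_conv]; if Re a + Re b <= 2 mu, one of the two qualifies. *)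
set (mu := (- 1 - Rmax 0 (- s))%R).
assert (I : forall N a b, (Re a - 1 <= s)%R -> (Re b - 1 <= s)%R ->
  (Re a + Re b <= 2 * mu + INR N)%R -> bigO_pow (conv (binomw w b) (binom a)) s).
{ clear a b; induction N as [|N IH]; intros a b Ha Hb HN.
  - simpl in HN; destruct (Rle_dec (Re b) mu) as [H|H].
    + apply bigO_pow_conv with (Re b - 1)%R.
      * unfold mu in H; lra.
      * now apply binomw_bigO.
      * apply bigO_pow_weaken with (1 := Ha), binom_bigO.
    + apply bigO_pow_ext with (conv (binom a) (binomw w b)); [intros; apply conv_comm|].
      apply bigO_pow_conv with (Re a - 1)%R.
      * unfold mu in *; lra.
      * apply binom_bigO.
      * now apply bigO_pow_weaken with (1 := Hb), binomw_bigO.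
  - rewrite S_INR in HN.
    apply bigO_pow_contiguous with (1 := Hw1) (2 := conv_contiguous a b w);
      apply IH; simpl; unfold Re in *; lra. }
destruct (nfloor_ex (Rmax 0 (Re a + Re b - 2 * mu)) (Rmax_l _ _)) as [N [_ HN]].
intros Ha Hb; apply I with (S N); [easy|easy|].
assert (H := Rmax_r 0 (Re a + Re b - 2 * mu)); rewrite S_INR; lra.
Qed.

(** (1 - w t)^(-b) solves (1 - w t) F' = b w F. For its Taylor polynomial the coefficients cancel in
    consecutive pairs, and only the top one remains. *)
Lemma binomw_partial_sum_derive (w b : C) (t : R) (n : nat) :
  exists D : C,
    is_Cderive (fun s => sum_n (G := C_AbelianMonoid) (fun k => binomw w b k * RtoC s ^ k) n) t D
    /\ (1 - w * t) * D
         - b * w * sum_n (G := C_AbelianMonoid) (fun k => binomw w b k * RtoC t ^ k) n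
       = - (INR n + b) * binom b n * w ^ S n * RtoC t ^ n.
Proof.
induction n as [|n [D [HD ED]]].
- exists 0; split.
  + apply is_Cderive_ext_loc with (fun _ => binomw w b 0);
      [apply filter_forall; intros s; rewrite sum_O; simpl; ring|apply is_Cderive_const].
  + rewrite sum_O; unfold binomw; rewrite binom_0; simpl; ring.
- assert (HP : is_Cderive (fun s => RtoC s ^ S n) t (RtoC (INR n + 1) * RtoC t ^ n)).
  { apply is_Cderive_ext_loc with (fun s => RtoC (s ^ S n));
      [apply filter_forall; intros s; apply RtoC_pow|].
    rewrite <- RtoC_pow, <- RtoC_mult; apply is_Cderive_RtoC.
    evar_last; [apply (is_derive_pow (fun s => s) (S n) t 1%R), (is_derive_id (K := R_AbsRing))|].
    change (INR (S n) * 1 * t ^ n = (INR n + 1) * t ^ n)%R; rewrite S_INR; ring. }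
  exists (D + binomw w b (S n) * (RtoC (INR n + 1) * RtoC t ^ n)); split.
  + apply is_Cderive_ext_loc with
      (fun s => sum_n (G := C_AbelianMonoid) (fun k => binomw w b k * RtoC s ^ k) n
                + binomw w b (S n) * RtoC s ^ S n).
    * apply filter_forall; intros s; now rewrite sum_n_C_S.
    * apply is_Cderive_plus; [easy|now apply is_Cderive_scal].
  + rewrite sum_n_C_S.
    match goal with |- ?L = ?R => replace L with
      (((1 - w * t) * D - b * w * sum_n (G := C_AbelianMonoid) (fun k => binomw w b k * RtoC t ^ k) n)
       + ((1 - w * t) * (binomw w b (S n) * (RtoC (INR n + 1) * RtoC t ^ n))
       - b * w * (binomw w b (S n) * RtoC t ^ S n))) by ring end.
    rewrite ED; unfold binomw; rewrite binom_S, S_INR, !RtoC_plus, !Cpow_S.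
    field; apply INR_S_neq_0.
Qed.

(** * The binomial series on the unit circle *)


(** |z^b| = exp (Re b ln |z| - Im b arg z), where the principal argument is bounded by PI. The
    radius 2 is what |1 - w t| needs. *)
Lemma Cmod_Cpower_bounded (b : C) (m : R) :
  (0 < m)%R ->
  exists M : R, forall z : C, (m <= Cmod z <= 2)%R -> (Cmod (Cpower z b) <= M)%R.
Proof.
intros Hm.
exists (exp (Rabs (Re b) * (Rabs (ln m) + Rabs (ln 2)) + Rabs (Im b) * PI)); intros z Hz.
unfold Cpower; rewrite Cmod_Cexp; apply exp_le_compat.
assert (Hz0 : z <> 0) by (apply Cmod_gt_0; lra).
assert (A := Carg_bounds z Hz0).
assert (L1 : (ln m <= ln (Cmod z))%R) by (apply ln_le; lra).
assert (L2 : (ln (Cmod z) <= ln 2)%R) by (apply ln_le; lra).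
replace (Re (b * Clog z)) with (Re b * ln (Cmod z) + - (Im b * Carg z))%R
  by (unfold Re, Im; simpl; ring).
apply Rplus_le_compat.
- apply Rle_trans with (1 := Rle_abs _); rewrite Rabs_mult.
  apply Rmult_le_compat_l; [apply Rabs_pos|].
  apply Rabs_le; assert (P := Rle_abs (ln 2)); assert (Q := Rle_abs (- ln m)).
  rewrite Rabs_Ropp in Q; assert (P' := Rabs_pos (ln 2)); assert (Q' := Rabs_pos (ln m)); lra.
- apply Rle_trans with (1 := Rle_abs _); rewrite Rabs_Ropp, Rabs_mult.
  apply Rmult_le_compat_l; [apply Rabs_pos|]; apply Rabs_le; lra.
Qed.

Lemma sum_n_pow_0 (u : nat -> C) (n : nat) :
  sum_n (G := C_AbelianMonoid) (fun k => u k * RtoC 0 ^ k) n = u O.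
Proof.
induction n as [|n IH]; [rewrite sum_O; simpl; ring|].
rewrite sum_n_C_S, IH, Cpow_S; simpl; ring.
Qed.

(* The function P_n(t) (1 - w t)^b, with P_n the n-th Taylor polynomial of
   (1 - w t)^(-b), equals 1 at t = 0 and has derivative
   - (n + b) binom b n w^(n+1) t^n (1 - w t)^(b-1) on [0, 1]. *)
Lemma binomw_partial_sum_bigO (w b : C) :
  Cmod w = 1%R -> (Re w < 1)%R ->
  bigO_pow (fun n => sum_n (G := C_AbelianMonoid) (binomw w b) n - Cpower (1 - w) (- b)) (Re b).
Proof.
intros Hw Hw1.
(* Re (1 - w t) is affine in t, so on [0, 1] it is at least the smaller of its end values. *)
set (m := Rmin 1 (1 - Re w)).
assert (Hm : (0 < m)%R) by (apply Rmin_glb_lt; lra).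
assert (HR : forall t, (0 <= t <= 1)%R -> (m <= Re (1 - w * t))%R).
{ intros t Ht; replace (Re (1 - w * t)) with (1 - Re w * t)%R by (unfold Re; simpl; ring).
  destruct (Rle_dec 0 (Re w)).
  - apply Rle_trans with (1 := Rmin_r _ _); nra.
  - apply Rle_trans with (1 := Rmin_l _ _); nra. }
assert (HM : forall t, (0 <= t <= 1)%R -> (m <= Cmod (1 - w * t) <= 2)%R).
{ intros t Ht; split.
  - apply Rle_trans with (1 := HR t Ht), Rle_trans with (2 := re_le_Cmod _), Rle_abs.
  - apply Rle_trans with (1 := Cmod_triangle _ _).
    rewrite Cmod_opp, Cmod_mult, Hw, Cmod_1, Cmod_R, Rabs_pos_eq; lra. }
destruct (Cmod_Cpower_bounded b m Hm) as [M0 HM0].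
assert (M0pos : (0 <= M0)%R).
{ apply Rle_trans with (2 := HM0 _ (HM 0%R ltac:(lra))), Cmod_ge_0. }
destruct (bigO_pow_nonneg _ _ (binom_bigO b)) as [K [K0 HK]].
set (L := Cpower (1 - w) (- b)).
(* 2 comes from [Cmod_increment_le], M0 / m bounds (1 - w t)^b / (1 - w t), (1 + |b|) K bounds (n +
   b) [binom b n] up to (n + 1)^(Re b), and |L| appears on dividing by (1 - w)^b. *)
exists (2 * (M0 / m * (1 + Cmod b) * K) * Cmod L)%R; intros n.
pose (P := (fun t => sum_n (G := C_AbelianMonoid) (fun k => binomw w b k * RtoC t ^ k) n) : R -> C).
assert (HD : forall t, (0 <= t <= 1)%R ->
  is_Cderive (fun s => P s * Cpower (1 - w * s) b) t
    (- (INR n + b) * binom b n * w ^ S n * RtoC t ^ n * (Cpower (1 - w * t) b / (1 - w * t)))).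
{ intros t Ht.
  assert (Hn : 1 - w * t <> 0) by (apply Cmod_gt_0; assert (H := HM t Ht); lra).
  destruct (binomw_partial_sum_derive w b t n) as [D [H1 H2]].
  eapply is_Cderive_eq.
  - apply is_Cderive_mult; [exact H1|].
    apply is_Cderive_Cpower with (l := - w); [assert (H := HR t Ht); lra|].
    eapply is_Cderive_eq.
    + apply (is_Cderive_plus (fun _ => 1) (fun s => - (w * RtoC s)) t 0 (- w)).
      * apply is_Cderive_const.
      * apply is_Cderive_ext_loc with (fun s => (- w) * RtoC s);
          [apply filter_forall; intros s; simpl; ring|].
        eapply is_Cderive_eq;
          [apply is_Cderive_scal, is_Cderive_RtoC, (is_derive_id (K := R_AbsRing))|].
        unfold one; simpl; ring.
    + ring.
  - rewrite <- H2; unfold P; field; exact Hn. }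
assert (B := Cmod_increment_le _ _ (M0 / m * (1 + Cmod b) * K * Rpower (INR n + 1) (Re b)) HD).
cbv beta in B.
assert (E1 : P 1%R = sum_n (G := C_AbelianMonoid) (binomw w b) n).
{ apply sum_n_ext; intros k; rewrite Cpow_1_l; apply Cmult_1_r. }
assert (E0 : P 0%R = 1).
{ unfold P; rewrite sum_n_pow_0; unfold binomw; rewrite binom_0; simpl; ring. }
replace (1 - w * RtoC 1) with (1 - w) in B by ring.
replace (1 - w * RtoC 0) with (RtoC 1) in B by ring.
rewrite E1, E0, (Cpower_pos 1), ln_1, Cmult_0_r, Cexp_0, Cmult_1_l in B by lra.
replace (sum_n (binomw w b) n - L)
  with ((sum_n (G := C_AbelianMonoid) (binomw w b) n * Cpower (1 - w) b - 1) * L).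
2: { generalize (sum_n (G := C_AbelianMonoid) (binomw w b) n : C); intros z.
     transitivity (z * (Cpower (1 - w) b * L) - L); [ring|].
     unfold L; rewrite Cpower_opp; ring. }
rewrite Cmod_mult.
replace (2 * (M0 / m * (1 + Cmod b) * K) * Cmod L * Rpower (INR n + 1) (Re b))%R
  with (2 * (M0 / m * (1 + Cmod b) * K * Rpower (INR n + 1) (Re b)) * Cmod L)%R by ring.
apply Rmult_le_compat_r; [apply Cmod_ge_0|].
apply B; intros t Ht.
assert (Hn : 1 - w * t <> 0) by (apply Cmod_gt_0; assert (H := HM t Ht); lra).
rewrite !Cmod_mult, Cmod_opp, !Cmod_pow, Hw, pow1, Rmult_1_r, Cmod_div by exact Hn.
rewrite Cmod_R, Rabs_pos_eq by lra.
apply Rle_trans with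
  (((1 + Cmod b) * (INR n + 1)) * (K * Rpower (INR n + 1) (Re b - 1)) * 1 * (M0 / m))%R.
- assert (Q := pos_INR n); assert (Q' := Cmod_ge_0 b).
  apply Rmult_le_compat.
  + repeat apply Rmult_le_pos; try apply Cmod_ge_0; apply pow_le; lra.
  + apply Rdiv_le_0_compat; [apply Cmod_ge_0|apply Cmod_gt_0, Hn].
  + apply Rmult_le_compat.
    * repeat apply Rmult_le_pos; apply Cmod_ge_0.
    * apply pow_le; lra.
    * apply Rmult_le_compat; try apply Cmod_ge_0; [|apply HK].
      apply Rle_trans with (1 := Cmod_triangle _ _); rewrite Cmod_R, Rabs_pos_eq by lra; nra.
    * rewrite <- (pow1 n); apply pow_incr; lra.
  + apply Rmult_le_compat; [apply Cmod_ge_0| |now apply HM0, HM|].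
    * left; apply Rinv_0_lt_compat, Cmod_gt_0, Hn.
    * apply Rinv_le_contravar; [easy|now apply HM].
- right; replace (Re b) with ((Re b - 1) + 1)%R at 2 by ring.
  rewrite Rpower_plus, Rpower_1 by apply INR_1_pos; field; lra.
Qed.

(** With U the generating function of [u], (U - L) (1 - t)^(-a) = ((U - L) / (1 - t)) (1 - t)^(-(a -
    1)), and dividing U - L by 1 - t yields the partial sums minus L. *)
Lemma conv_summation_by_parts (u : nat -> C) (a L : C) (n : nat) :
  conv u (binom a) n - L * binom a n
  = conv (fun k => sum_n (G := C_AbelianMonoid) u k - L) (binom (a - 1)) n.
Proof.
set (T := fun k => sum_n (G := C_AbelianMonoid) u k - L).
destruct n as [|n].
- unfold conv, T; rewrite !sum_O, !binom_0; simpl; ring.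
- rewrite (conv_comm T), (conv_shift (binom a) (binom (a - 1)) T 1), !(conv_comm _ T).
  2: now rewrite !binom_0.
  2: intros k; rewrite binom_pred; ring.
  (* The coefficients of U - L: those of [u], with L subtracted at index 0 only. *)
  set (u' := fun k => match k with O => T O | S j => u (S j) end).
  replace (conv T (binom a) (S n) - 1 * conv T (binom a) n) with (conv u' (binom a) (S n)).
  2: { apply conv_shift; [reflexivity|].
       intros k; unfold u', T; rewrite sum_n_C_S; ring. }
  unfold conv; rewrite !sum_n_shift; unfold u', T; rewrite sum_O, Nat.sub_0_r.
  unfold plus; simpl; ring.
Qed.

(** Induction on how far Re b must be lowered. At the bottom, the partial sums minus their limit
    decay fast enough for summation by parts. In the step the main terms match because (1 - w) (1 -
    w)^(-b) = (1 - w)^(-(b - 1)); the term with a - 1 is bounded whole by [conv_binom_bigO]. *)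
Lemma conv_binom_error (w a b : C) (s : R) :
  Cmod w = 1%R -> (Re w < 1)%R -> (Re a - 2 <= s)%R -> (Re b - 1 <= s)%R ->
  bigO_pow (fun n => conv (binomw w b) (binom a) n - Cpower (1 - w) (- b) * binom a n) s.
Proof.
intros Hw Hw1 Ha.
assert (Hn : 1 - w <> 0).
{ intros H; apply (f_equal Re) in H; unfold Re in *; simpl in H; lra. }
assert (I : forall N b, (Re b - 1 <= s)%R -> (Re b <= - 2 - Rmax 0 (- s) + INR N)%R ->
  bigO_pow (fun n => conv (binomw w b) (binom a) n - Cpower (1 - w) (- b) * binom a n) s).
{ clear b; induction N as [|N IH]; intros b Hb HN.
  - simpl in HN.
    eapply bigO_pow_ext; [intros n; symmetry; apply conv_summation_by_parts|].
    apply bigO_pow_conv with (Re b); [lra|now apply binomw_partial_sum_bigO|].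
    apply bigO_pow_weaken with (2 := binom_bigO _); unfold Re in *; simpl; lra.
  - rewrite S_INR in HN.
    apply bigO_pow_contiguous with w
      (fun n => conv (binomw w (b - 1)) (binom a) n - Cpower (1 - w) (- (b - 1)) * binom a n)
      (conv (binomw w b) (binom (a - 1))).
    + exact Hn.
    + intros n; replace (- (b - 1)) with (- b + 1) by ring.
      rewrite Cpower_plus, Cpower_1 by exact Hn.
      transitivity ((1 - w) * conv (binomw w b) (binom a) n
                    - Cpower (1 - w) (- b) * (1 - w) * binom a n); [ring|].
      rewrite conv_contiguous; ring.
    + apply IH; unfold Re in *; simpl; lra.
    + apply conv_binom_bigO; try easy; unfold Re in *; simpl; lra. }
intros Hb.
destruct (nfloor_ex (Rmax 0 (Re b + 2 + Rmax 0 (- s))) (Rmax_l _ _)) as [N [_ HN]].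
apply I with (S N); [easy|].
assert (H := Rmax_r 0 (Re b + 2 + Rmax 0 (- s))); rewrite S_INR; lra.
Qed.

(** * Gauss's primitive for Euler's integral *)


Lemma Re_pos_neq_0 (z : C) : (0 < Re z)%R -> z <> 0.
Proof. intros H ->; simpl in H; lra. Qed.

Lemma RtoC_neq_0 (r : R) : r <> 0%R -> RtoC r <> 0.
Proof. intros H E; apply H; now apply RtoC_inj. Qed.

Lemma Cpower_succ (t : R) (a : C) : (0 < t)%R -> Cpower t (a + 1) = Cpower t a * t.
Proof.
intros Ht; rewrite Cpower_plus, Cpower_1; [reflexivity|].
apply RtoC_neq_0; lra.
Qed.

Lemma is_Cderive_Cpower_pos (a : C) (t : R) :
  (0 < t)%R -> is_Cderive (fun s => Cpower (RtoC s) a) t (a * Cpower t (a - 1)).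
Proof.
intros Ht; eapply is_Cderive_eq.
- apply (is_Cderive_Cpower (fun s => RtoC s) t 1 a); [exact Ht|].
  apply is_Cderive_RtoC, (is_derive_id (K := R_AbsRing)).
- replace a with ((a - 1) + 1) at 2 by ring.
  rewrite Cpower_succ by easy; field; apply RtoC_neq_0; lra.
Qed.

Lemma Cpoch_S_l (a : C) (k : nat) : Cpoch a (S k) = a * Cpoch (a + 1) k.
Proof.
induction k as [|k IH]; [simpl; ring|].
change (Cpoch a (S (S k))) with (Cpoch a (S k) * (a + INR (S k))).
rewrite IH, S_INR, RtoC_plus; simpl; ring.
Qed.

Lemma Cpoch_neq_0 (a : C) (k : nat) : (0 < Re a)%R -> Cpoch a k <> 0.
Proof.
intros Ha; induction k as [|k IH]; simpl; [apply RtoC_neq_0; lra|].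
apply Cmult_neq_0; [exact IH|].
apply Re_pos_neq_0; unfold Re in *; simpl; assert (P := pos_INR k); lra.
Qed.

(* Primitive of t^(a-1) (1 - t/N)^m given by m integrations by parts. *)
Fixpoint gauss_prim (N : R) (m : nat) (a : C) (t : R) : C :=
  match m with
  | O => Cpower t a / a
  | S j => Cpower t a * RtoC ((1 - t / N) ^ S j) / a
           + INR (S j) / (N * a) * gauss_prim N j (a + 1) t
  end.

Lemma gauss_prim_derive (N : R) (m : nat) (a : C) (t : R) :
  (0 < N)%R -> (0 < Re a)%R -> (0 < t)%R ->
  is_Cderive (gauss_prim N m a) t (Cpower t (a - 1) * RtoC ((1 - t / N) ^ m)).
Proof.
intros HN; revert a; induction m as [|m IH]; intros a Ha Ht;
  assert (Ha0 := Re_pos_neq_0 a Ha).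
- apply is_Cderive_ext_loc with (fun s => / a * Cpower (RtoC s) a);
    [apply filter_forall; intros s; unfold gauss_prim, Cdiv; ring|].
  eapply is_Cderive_eq; [apply is_Cderive_scal, is_Cderive_Cpower_pos, Ht|].
  simpl; field; exact Ha0.
- assert (HP : is_Cderive (fun s => RtoC ((1 - s / N) ^ S m)) t
                 (RtoC (- (INR (S m) / N) * (1 - t / N) ^ m))).
  { apply is_Cderive_RtoC; evar_last.
    - apply (is_derive_pow (fun s => 1 - s / N)%R (S m) t (- / N)%R).
      auto_derive; [easy|field; lra].
    - simpl pred; field; lra. }
  apply is_Cderive_ext_loc with
    (fun s => / a * (Cpower (RtoC s) a * RtoC ((1 - s / N) ^ S m))
              + INR (S m) / (N * a) * gauss_prim N m (a + 1) s).
  { apply filter_forall; intros s; unfold Cdiv; cbn [gauss_prim]; unfold Cdiv; ring. }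
  eapply is_Cderive_eq.
  + apply is_Cderive_plus; apply is_Cderive_scal.
    * apply is_Cderive_mult; [apply is_Cderive_Cpower_pos, Ht|exact HP].
    * apply IH; [unfold Re in *; simpl; lra|exact Ht].
  + replace (a + 1 - 1) with a by ring.
    rewrite RtoC_mult, RtoC_opp, RtoC_div by lra.
    field; split; [exact Ha0|apply RtoC_neq_0; lra].
Qed.

(** At t = N every boundary term contains a positive power of 1 - N/N = 0, so only the innermost
    N^(a+m) / (a+m) survives; its surplus N^m cancels against the prefactors. *)
Lemma gauss_prim_end (N : R) (m : nat) (a : C) :
  (0 < N)%R -> (0 < Re a)%R ->
  gauss_prim N m a N = Cpower N a * INR (fact m) / Cpoch a (S m).
Proof.
intros HN; revert a; induction m as [|m IH]; intros a Ha;
  assert (Ha0 := Re_pos_neq_0 a Ha).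
- simpl; rewrite Cplus_0_r, Cmult_1_l; field; exact Ha0.
- assert (Ha1 : (0 < Re (a + 1))%R) by (unfold Re in *; simpl; lra).
  cbn [gauss_prim]; rewrite (IH (a + 1) Ha1), (Cpoch_S_l a (S m)), Cpower_succ by easy.
  replace (1 - N / N)%R with 0%R by (field; lra); rewrite pow_i by lia.
  rewrite (fact_simpl m), mult_INR, RtoC_mult.
  field; repeat split; try exact Ha0; try (apply RtoC_neq_0; lra).
  now apply Cpoch_neq_0.
Qed.

(** Serves to show that the primitive vanishes at 0+, so [K] may depend on N and m: on (0, N]
    surplus powers of t are absorbed as powers of N. *)
Lemma Cmod_gauss_prim_le (N : R) (m : nat) (a : C) :
  (0 < N)%R -> (0 < Re a)%R ->
  exists K : R, (0 <= K)%R /\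
    forall t, (0 < t <= N)%R -> (Cmod (gauss_prim N m a t) <= K * Rpower t (Re a))%R.
Proof.
intros HN; revert a; induction m as [|m IH]; intros a Ha;
  assert (Ha0 := Re_pos_neq_0 a Ha); assert (Hm := proj1 (Cmod_gt_0 a) Ha0).
- exists (/ Cmod a)%R; split; [left; now apply Rinv_0_lt_compat|].
  intros t Ht; simpl; rewrite Cmod_div, Cmod_Cpower_pos by easy; right; field; lra.
- destruct (IH (a + 1)) as [K [K0 HK]]; [unfold Re in *; simpl; lra|].
  set (c := Cmod (INR (S m) / (N * a))).
  exists (/ Cmod a + c * (K * N))%R; split.
  { apply Rplus_le_le_0_compat; [left; now apply Rinv_0_lt_compat|].
    apply Rmult_le_pos; [apply Cmod_ge_0|apply Rmult_le_pos; lra]. }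
  intros t Ht; cbn [gauss_prim]; apply Rle_trans with (1 := Cmod_triangle _ _).
  rewrite Rmult_plus_distr_r; apply Rplus_le_compat.
  + unfold Cdiv; rewrite !Cmod_mult, Cmod_inv, Cmod_R, Cmod_Cpower_pos by easy.
    rewrite (Rmult_comm (/ _)); apply Rmult_le_compat_r; [left; now apply Rinv_0_lt_compat|].
    rewrite <- (Rmult_1_r (Rpower t (Re a))) at 2.
    apply Rmult_le_compat_l; [left; apply Rpower_pos|].
    assert (0 <= 1 - t / N <= 1)%R.
    { assert (t / N <= 1)%R by (apply Rle_div_l; lra).
      assert (0 < t / N)%R by (apply Rdiv_lt_0_compat; lra); lra. }
    rewrite Rabs_pos_eq by now apply pow_le.
    apply Rle_trans with (1 ^ S m)%R; [apply pow_incr; lra|rewrite pow1; lra].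
  + rewrite Cmod_mult; fold c; rewrite !Rmult_assoc.
    apply Rmult_le_compat_l; [apply Cmod_ge_0|].
    apply Rle_trans with (1 := HK t Ht); apply Rmult_le_compat_l; [easy|].
    replace (Re (a + 1)) with (Re a + 1)%R by (unfold Re; simpl; ring).
    rewrite Rpower_plus, Rpower_1, Rmult_comm by easy.
    apply Rmult_le_compat_r; [left; apply Rpower_pos|apply Ht].
Qed.

Lemma gauss_prim_at_0 (N : R) (m : nat) (a : C) (eps : R) :
  (0 < N)%R -> (0 < Re a)%R -> (0 < eps)%R ->
  at_right 0 (fun x => 0 < x < N /\ Cmod (gauss_prim N m a x) < eps)%R.
Proof.
intros HN Ha He.
destruct (Cmod_gauss_prim_le N m a HN Ha) as [K [K0 HK]].
(* Chosen so that d^(Re a) = eps / (K + 1); K + 1 avoids a division by zero. *)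
set (d := Rpower (eps / (K + 1)) (/ Re a)).
assert (Hd : (0 < Rmin N d)%R) by (apply Rmin_glb_lt; [easy|apply Rpower_pos]).
exists (mkposreal _ Hd); intros x Hx Hx0.
assert (Hx' : (x < Rmin N d)%R).
{ apply (Rabs_lt_between' x 0) in Hx; simpl in Hx; lra. }
assert (H1 := Rlt_le_trans _ _ _ Hx' (Rmin_l _ _)).
assert (H2 := Rlt_le_trans _ _ _ Hx' (Rmin_r _ _)).
split; [lra|].
apply Rle_lt_trans with (1 := HK x ltac:(lra)).
assert (E0 : (0 < eps / (K + 1))%R) by (apply Rdiv_lt_0_compat; lra).
assert (H3 : (Rpower x (Re a) < eps / (K + 1))%R).
{ replace (eps / (K + 1))%R with (Rpower d (Re a)).
  - apply Rlt_Rpower_l; lra.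
  - unfold d; rewrite Rpower_mult, Rinv_l, Rpower_1; lra. }
apply Rle_lt_trans with ((K + 1) * Rpower x (Re a))%R.
- apply Rmult_le_compat_r; [left; apply Rpower_pos|lra].
- apply Rlt_div_r in H3; lra.
Qed.

Lemma pow_exp_neg (t : R) (n : nat) :
  (0 < INR n)%R -> (exp (- t) = exp (- (t / INR n)) ^ n)%R.
Proof.
intros Hn; rewrite <- Rpower_pow by apply exp_pos.
unfold Rpower; rewrite ln_exp; f_equal; field; lra.
Qed.

(** With q = t / n, the lower bound is 1 - q <= exp (-q). For the upper bound, Bernoulli gives 1 - n
    q^2 <= (1 - q^2)^n = (1 - q)^n (1 + q)^n <= (1 - q)^n exp t; then multiply by exp (-t). *)
Lemma exp_sub_gauss_bounds (t : R) (n : nat) :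
  (1 <= n)%nat -> (0 <= t <= INR n)%R ->
  (0 <= exp (- t) - (1 - t / INR n) ^ n <= t ^ 2 * exp (- t) / INR n)%R.
Proof.
intros Hn Ht.
assert (Pn : (0 < INR n)%R) by (apply lt_0_INR; lia).
set (q := (t / INR n)%R).
assert (Hq : (0 <= q <= 1)%R).
{ unfold q; split; [apply Rdiv_le_0_compat; lra|apply Rle_div_l; lra]. }
assert (E1 := pow_exp_neg t n Pn); fold q in E1.
split.
- assert ((1 - q) ^ n <= exp (- t))%R; [|lra].
  rewrite E1; apply pow_incr; assert (H := exp_ineq1_le (- q)); lra.
- assert (B : forall m, (1 - INR m * q ^ 2 <= (1 - q ^ 2) ^ m)%R).
  { assert (0 <= q ^ 2 <= 1)%R by nra.
    induction m as [|m IH]; [simpl; lra|].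
    rewrite S_INR; change ((1 - q ^ 2) ^ S m)%R with ((1 - q ^ 2) * (1 - q ^ 2) ^ m)%R.
    assert (0 <= INR m * q ^ 2 * q ^ 2)%R
      by (assert (P := pos_INR m); apply Rmult_le_pos; [apply Rmult_le_pos|]; lra).
    apply Rle_trans with ((1 - q ^ 2) * (1 - INR m * q ^ 2))%R; [nra|].
    apply Rmult_le_compat_l; lra. }
  assert (E2 : ((1 - q ^ 2) ^ n <= (1 - q) ^ n * exp t)%R).
  { replace (1 - q ^ 2)%R with ((1 - q) * (1 + q))%R by ring.
    rewrite Rpow_mult_distr; apply Rmult_le_compat_l; [apply pow_le; lra|].
    rewrite <- (Ropp_involutive t), (pow_exp_neg (- t) n Pn).
    apply pow_incr; split; [lra|].
    replace (- (- t / INR n))%R with q by (unfold q; field; lra).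
    assert (H := exp_ineq1_le q); lra. }
  assert (E3 := Rle_trans _ _ _ (B n) E2).
  apply (Rmult_le_compat_r (exp (- t))) in E3; [|left; apply exp_pos].
  rewrite Rmult_assoc, <- exp_plus, Rplus_opp_r, exp_0, Rmult_1_r in E3.
  replace (INR n * q ^ 2)%R with (t ^ 2 / INR n)%R in E3 by (unfold q; field; lra).
  unfold Rdiv in *; lra.
Qed.

(** t^s exp (-t/2) is largest at t = 2 s: apply ln u <= u - 1 to u = t / (2 s), and drop the factor
    exp (-s). *)
Lemma Rpower_exp_half_bound (s t : R) :
  (0 < s)%R -> (0 < t)%R ->
  (Rpower t s * exp (- t) <= exp (s * ln (2 * s)) * exp (- (t / 2)))%R.
Proof.
intros Hs Ht; unfold Rpower; rewrite <- !exp_plus; apply exp_le_compat.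
assert (H := ln_le_minus_1 (t / (2 * s)) ltac:(apply Rdiv_lt_0_compat; lra)).
rewrite ln_div in H by lra.
apply (Rmult_le_compat_l s) in H; [|lra].
replace (s * (t / (2 * s) - 1))%R with (t / 2 - s)%R in H by (field; lra).
lra.
Qed.

Definition gamma_integrand (a : C) (t : R) : C :=
  Cpower (RtoC t) (a - 1) * RtoC (exp (- t)).

Lemma gamma_integrand_continuous (a : C) (t : R) :
  (0 < t)%R -> continuous (U := C_R_NormedModule) (gamma_integrand a) t.
Proof.
intros Ht; eapply is_Cderive_continuous.
apply is_Cderive_mult; [now apply is_Cderive_Cpower_pos|].
apply is_Cderive_RtoC; auto_derive; [easy|reflexivity].
Qed.

Lemma gauss_integrand_continuous (a : C) (N t : R) (m : nat) :
  (0 < N)%R -> (0 < t)%R ->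
  continuous (U := C_R_NormedModule) (fun s => Cpower (RtoC s) (a - 1) * RtoC ((1 - s / N) ^ m)) t.
Proof.
intros HN Ht; eapply is_Cderive_continuous.
apply is_Cderive_mult; [now apply is_Cderive_Cpower_pos|].
apply is_Cderive_RtoC; auto_derive; [easy|reflexivity].
Qed.

Lemma is_RInt_exp_half (K x y : R) :
  is_RInt (fun t => K * exp (- (t / 2)))%R x y
    (2 * K * exp (- (x / 2)) - 2 * K * exp (- (y / 2)))%R.
Proof.
evar_last.
- apply (is_RInt_derive (V := R_CompleteNormedModule) (fun t => - (2 * K * exp (- (t / 2))))%R).
  + intros t _; auto_derive; [easy|]; unfold Rdiv; field.
  + intros t _; apply (ex_derive_continuous (V := R_NormedModule)); auto_derive; easy.
- unfold minus, plus, opp; simpl; ring.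
Qed.

(** * Euler's integral as a limit *)


Lemma C_R_norm_Cmod (z : C) : norm (V := C_R_NormedModule) z = Cmod z.
Proof.
change (sqrt (Rabs (fst z) ^ 2 + Rabs (snd z) ^ 2) = Cmod z).
unfold Cmod; now rewrite !pow2_abs.
Qed.

(** 2 K is the integral of K exp (-t/2) over the half-line, hence a bound uniform in x and y. *)
Lemma RInt_exp_half_dominated (f : R -> C) (l : C) (K x y : R) :
  (0 <= K)%R -> (0 <= x <= y)%R ->
  (forall t, (x <= t <= y)%R -> (Cmod (f t) <= K * exp (- (t / 2)))%R) ->
  is_RInt (V := C_R_NormedModule) f x y l -> (Cmod l <= 2 * K)%R.
Proof.
intros HK Hxy Hf Hl.
apply Rle_trans with (2 * K * exp (- (x / 2)) - 2 * K * exp (- (y / 2)))%R.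
- rewrite <- C_R_norm_Cmod.
  refine (norm_RInt_le (V := C_R_NormedModule) f (fun t => K * exp (- (t / 2)))%R x y l _
    (proj2 Hxy) _ Hl (is_RInt_exp_half K x y)).
  intros t Ht; rewrite C_R_norm_Cmod; now apply Hf.
- assert (H := exp_pos (- (y / 2))).
  assert (H' : (exp (- (x / 2)) <= 1)%R) by (rewrite <- exp_0; apply exp_le_compat; lra).
  assert (0 <= 2 * K * exp (- (y / 2)))%R by (apply Rmult_le_pos; lra).
  assert (2 * K * exp (- (x / 2)) <= 2 * K * 1)%R by (apply Rmult_le_compat_l; lra).
  lra.
Qed.

Lemma Cmod_gamma_integrand_sub_le (a : C) (n : nat) (t : R) :
  (1 <= n)%nat -> (0 < t <= INR n)%R ->
  (Cmod (gamma_integrand a t - Cpower (RtoC t) (a - 1) * RtoC ((1 - t / INR n) ^ n))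
   <= Rpower t (Re a + 1) * exp (- t) / INR n)%R.
Proof.
intros Hn Ht; unfold gamma_integrand.
replace (_ - _) with (Cpower (RtoC t) (a - 1) * RtoC (exp (- t) - (1 - t / INR n) ^ n))
  by (rewrite RtoC_minus; ring).
assert (B := exp_sub_gauss_bounds t n Hn ltac:(lra)).
rewrite Cmod_mult, Cmod_R, Cmod_Cpower_pos, Rabs_pos_eq by lra.
apply Rle_trans with (Rpower t (Re (a - 1)) * (t ^ 2 * exp (- t) / INR n))%R.
- apply Rmult_le_compat_l; [left; apply Rpower_pos|apply B].
- replace (Re a + 1)%R with (Re (a - 1) + INR 2)%R by (unfold Re; simpl; ring).
  rewrite Rpower_plus, Rpower_pow by lra; right; unfold Rdiv; ring.
Qed.

(** Beyond n the factor t^2 / n is at least 1, so inserting it gives the tail the same majorant as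
    the difference of integrands on (0, n]. *)
Lemma Cmod_gamma_integrand_tail_le (a : C) (n : nat) (t : R) :
  (1 <= n)%nat -> (INR n <= t)%R ->
  (Cmod (gamma_integrand a t) <= Rpower t (Re a + 1) * exp (- t) / INR n)%R.
Proof.
intros Hn Ht; assert (P : (1 <= INR n)%R) by (apply (le_INR 1); lia).
unfold gamma_integrand; rewrite Cmod_mult, Cmod_R, Cmod_Cpower_pos, Rabs_pos_eq
  by (lra || (left; apply exp_pos)).
replace (Re a + 1)%R with (Re (a - 1) + INR 2)%R by (unfold Re; simpl; ring).
rewrite Rpower_plus, Rpower_pow by lra.
replace (Rpower t (Re (a - 1)) * t ^ 2 * exp (- t) / INR n)%R
  with (Rpower t (Re (a - 1)) * exp (- t) * (t ^ 2 / INR n))%R by (field; lra).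
rewrite <- (Rmult_1_r (Rpower t _ * exp (- t))) at 1.
apply Rmult_le_compat_l.
- apply Rmult_le_pos; left; [apply Rpower_pos|apply exp_pos].
- apply Rle_div_r; nra.
Qed.

Lemma ex_RInt_gamma_integrand (a : C) (x y : R) :
  (0 < x)%R -> (0 < y)%R -> ex_RInt (V := C_R_NormedModule) (gamma_integrand a) x y.
Proof.
intros Hx Hy; apply (ex_RInt_continuous (V := C_R_CompleteNormedModule)).
intros t Ht; apply gamma_integrand_continuous.
apply Rlt_le_trans with (2 := proj1 Ht); now apply Rmin_glb_lt.
Qed.

Lemma RInt_gamma_integrand_approx (a : C) :
  (0 < Re a)%R ->
  exists K : R, (0 <= K)%R /\ forall (n : nat) (x y : R),
    (1 <= n)%nat -> (0 < x < INR n)%R -> (INR n < y)%R ->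
    (Cmod (RInt (V := C_R_CompleteNormedModule) (gamma_integrand a) x y
           - (gauss_prim (INR n) n a (INR n) - gauss_prim (INR n) n a x)) <= K / INR n)%R.
Proof.
intros Ha; set (s := (Re a + 1)%R); set (K := exp (s * ln (2 * s))).
assert (K0 : (0 < K)%R) by apply exp_pos.
exists (4 * K)%R; split; [lra|]; intros n x y Hn Hx Hy.
assert (Pn : (0 < INR n)%R) by (apply lt_0_INR; lia).
assert (KB : forall t, (0 < t)%R ->
  (Rpower t s * exp (- t) / INR n <= K / INR n * exp (- (t / 2)))%R).
{ intros t Ht; replace (K / INR n * exp (- (t / 2)))%R with (K * exp (- (t / 2)) / INR n)%R
    by (field; lra).
  apply Rmult_le_compat_r; [left; now apply Rinv_0_lt_compat|].
  apply Rpower_exp_half_bound; unfold s; lra. }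
assert (I1 := RInt_correct (V := C_R_CompleteNormedModule) _ _ _
          (ex_RInt_gamma_integrand a x (INR n) ltac:(lra) ltac:(lra))).
assert (I2 := RInt_correct (V := C_R_CompleteNormedModule) _ _ _
          (ex_RInt_gamma_integrand a (INR n) y ltac:(lra) ltac:(lra))).
assert (I3 : is_RInt (V := C_R_NormedModule)
   (fun t => Cpower (RtoC t) (a - 1) * RtoC ((1 - t / INR n) ^ n)) x (INR n)
   (gauss_prim (INR n) n a (INR n) - gauss_prim (INR n) n a x)).
{ apply is_RInt_Cderive; rewrite Rmin_left, Rmax_right by lra; intros t Ht.
  - apply gauss_prim_derive; lra.
  - apply gauss_integrand_continuous; lra. }
rewrite <- (RInt_Chasles (V := C_R_CompleteNormedModule) (gamma_integrand a) x (INR n) y)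
  by (apply ex_RInt_gamma_integrand; lra).
set (F1 := RInt (V := C_R_CompleteNormedModule) (gamma_integrand a) x (INR n)) in *.
set (F2 := RInt (V := C_R_CompleteNormedModule) (gamma_integrand a) (INR n) y) in *.
set (G := gauss_prim (INR n) n a (INR n) - gauss_prim (INR n) n a x) in *.
assert (B1 : (Cmod (F1 - G) <= 2 * (K / INR n))%R).
{ apply RInt_exp_half_dominated with (4 := is_RInt_minus _ _ _ _ _ _ I1 I3).
  - left; now apply Rdiv_lt_0_compat.
  - lra.
  - intros t Ht; apply Rle_trans with (2 := KB t ltac:(lra)).
    apply Cmod_gamma_integrand_sub_le; [easy|lra]. }
assert (B2 : (Cmod F2 <= 2 * (K / INR n))%R).
{ apply RInt_exp_half_dominated with (4 := I2).
  - left; now apply Rdiv_lt_0_compat.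
  - lra.
  - intros t Ht; apply Rle_trans with (2 := KB t ltac:(lra)).
    apply Cmod_gamma_integrand_tail_le; [easy|lra]. }
change (Cmod ((F1 + F2 : C) - G) <= 4 * K / INR n)%R.
replace ((F1 + F2 : C) - G) with ((F1 - G : C) + F2) by ring.
apply Rle_trans with (1 := Cmod_triangle _ _).
unfold Rdiv in *; lra.
Qed.

Lemma CGamma_approx (a : C) :
  (0 < Re a)%R ->
  exists K : R, (0 <= K)%R /\ forall n : nat, (1 <= n)%nat ->
    (Cmod (CGamma a - Cpower (INR n) a * INR (fact n) / Cpoch a (S n)) <= K / INR n)%R.
Proof.
intros Ha; destruct (RInt_gamma_integrand_approx a Ha) as [K [K0 HK]].
exists K; split; [easy|].
set (Fl := filter_prod (at_right 0) (Rbar_locally p_infty)).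
assert (PF : ProperFilter Fl)
  by apply filter_prod_proper.
set (I := fun ab : R * R => RInt (V := C_R_CompleteNormedModule) (gamma_integrand a) (fst ab) (snd ab)).
set (Gn := fun n : nat => gauss_prim (INR n) n a (INR n)).
assert (near : forall (n : nat) (eps : R), (1 <= n)%nat -> (0 < eps)%R ->
  Fl (fun ab => Cmod ((I ab : C) - Gn n) < K / INR n + eps)%R).
{ intros n eps Hn He.
  assert (Pn : (0 < INR n)%R) by (apply lt_0_INR; lia).
  exists (fun x => 0 < x < INR n /\ Cmod (gauss_prim (INR n) n a x) < eps)%R (fun y => INR n < y)%R.
  - now apply gauss_prim_at_0.
  - now exists (INR n).
  - intros x y [Hx Hx'] Hy; unfold I; simpl.
    assert (H := HK n x y Hn Hx Hy); fold (Gn n) in H.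
    set (R := RInt _ _ _) in *; set (p := gauss_prim (INR n) n a x) in *.
    replace (R - Gn n) with ((R - (Gn n - p)) - p) by ring.
    apply Rle_lt_trans with (1 := Cmod_triangle _ _); rewrite Cmod_opp; lra. }
assert (Fpos : Fl (fun ab => 0 < fst ab /\ 0 < snd ab)%R).
{ exists (fun x => 0 < x)%R (fun y => 0 < y)%R.
  - now exists (mkposreal 1 Rlt_0_1).
  - now exists 0%R.
  - intros x y Hx Hy; now split. }
(* Convergence at both ends at once: near the filter every truncated integral lies within K / n +
   eps of the same number [Gn n], which is the Cauchy criterion. Here n > 4 K / eps. *)
assert (Lex : exists l : C_R_CompleteNormedModule, filterlim I Fl (locally l)).
{ apply (filterlim_locally_cauchy (U := C_R_CompleteNormedModule) (F := Fl) I); intros eps.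
  destruct (nfloor_ex (4 * K / eps)) as [N [_ HN]].
  { apply Rdiv_le_0_compat; [lra|apply cond_pos]. }
  set (n := S N).
  exists (fun ab => Cmod ((I ab : C) - Gn n) < K / INR n + eps / 4)%R; split.
  - apply near; [unfold n; lia|]; assert (H := cond_pos eps); lra.
  - intros u v Hu Hv; apply C_NormedModule_mixin_compat1.
    change (Cmod ((I v : C) - I u) < eps)%R.
    replace ((I v : C) - I u) with (((I v : C) - Gn n) + - ((I u : C) - Gn n)) by ring.
    apply Rle_lt_trans with (1 := Cmod_triangle _ _); rewrite Cmod_opp.
    assert (H : (K / INR n <= eps / 4)%R); [|lra].
    unfold n; rewrite S_INR; assert (P := INR_1_pos N); assert (E := cond_pos eps).
    apply Rle_div_l; [easy|].
    assert (H : (4 * K / eps * eps <= (INR N + 1) * eps)%R) by (apply Rmult_le_compat_r; lra).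
    replace (4 * K / eps * eps)%R with (4 * K)%R in H by (field; lra); lra. }
destruct Lex as [l Hl].
assert (EG : CGamma a = l).
{ refine (@is_RInt_gen_unique C_R_CompleteNormedModule (at_right 0) (Rbar_locally p_infty)
    (Proper_StrongProper _ (at_right_proper_filter 0))
    (Proper_StrongProper _ (Rbar_locally_filter p_infty)) (gamma_integrand a) l _).
  apply (filterlimi_lim_ext_loc I); [|exact Hl].
  revert Fpos; apply filter_imp; intros [x y] [Hx Hy].
  apply (RInt_correct (V := C_R_CompleteNormedModule)), ex_RInt_gamma_integrand; assumption. }
intros n Hn; rewrite EG, <- gauss_prim_end; [fold (Gn n)|apply lt_0_INR; lia|exact Ha].
apply le_epsilon; intros eps He.
(* Balls are taken by components, so returning to the modulus costs sqrt 2 <= 2; eps / 4 therefore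
   leaves eps / 2. *)
assert (Hb : Fl (fun ab => ball (M := C_R_CompleteNormedModule) l (eps / 4)%R (I ab))).
{ apply Hl; exists (mkposreal (eps / 4) ltac:(lra)); now intros z Hz. }
destruct (filter_ex _ (filter_and _ _ Hb (near n (eps / 2)%R Hn ltac:(lra)))) as [ab [H1 H2]].
apply (C_NormedModule_mixin_compat2 l (I ab) (mkposreal (eps / 4) ltac:(lra))) in H1.
change (Cmod ((I ab : C) - l) < sqrt 2 * (eps / 4))%R in H1.
assert (S2 : (sqrt 2 <= 2)%R).
{ rewrite <- (sqrt_Rsqr 2) at 2 by lra; apply sqrt_le_1_alt; unfold Rsqr; lra. }
replace (l - Gn n) with (((I ab : C) - Gn n) + - ((I ab : C) - l)) by ring.
apply Rle_trans with (1 := Cmod_triangle _ _); rewrite Cmod_opp.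
assert (sqrt 2 * (eps / 4) <= 2 * (eps / 4))%R by (apply Rmult_le_compat_r; lra); lra.
Qed.

(** * Asymptotics *)


(** (x + 1) / x lies between 1 and 2. This turns [bigO_pow] bounds in n + 1 into bounds in n. *)
Lemma Rpower_succ_le (x s : R) :
  (1 <= x)%R -> (Rpower (x + 1) s <= Rpower 2 (Rabs s) * Rpower x s)%R.
Proof.
intros Hx; unfold Rpower; rewrite <- exp_plus; apply exp_le_compat.
assert (L := ln_succ_bounds x ltac:(lra)).
assert (0 < / (x + 1))%R by (apply Rinv_0_lt_compat; lra).
assert (U : (ln (x + 1) - ln x <= ln 2)%R).
{ rewrite <- ln_div by lra; apply ln_le; [apply Rdiv_lt_0_compat; lra|apply Rle_div_l; lra]. }
assert (S := Rle_abs s); assert (P := Rabs_pos s).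
assert (s * (ln (x + 1) - ln x) <= Rabs s * (ln (x + 1) - ln x))%R
  by (apply Rmult_le_compat_r; lra).
assert (Rabs s * (ln (x + 1) - ln x) <= Rabs s * ln 2)%R
  by (apply Rmult_le_compat_l; lra).
lra.
Qed.

Lemma gauss_quotient_binom (a : C) (n : nat) :
  (0 < Re a)%R -> (1 <= n)%nat ->
  binom a n * ((a + INR n) * (Cpower (INR n) a * INR (fact n) / Cpoch a (S n)))
  = Cpower (INR n) a.
Proof.
intros Ha Hn; unfold binom; simpl Cpoch; field; split; [|split].
- apply Re_pos_neq_0; unfold Re in *; simpl; assert (P := pos_INR n); lra.
- now apply Cpoch_neq_0.
- apply INR_fact_C_neq_0.
Qed.

(** By [gauss_quotient_binom] the quotient equals n^a / ((a + n) [binom a n]), and the denominator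
    is O(n^(Re a)) by [binom_bigO]. Together with the rate in [CGamma_approx] this forces a nonzero
    limit. *)
Lemma gauss_quotient_lower_bound (a : C) :
  (0 < Re a)%R ->
  exists M : R, (0 < M)%R /\ forall n : nat, (1 <= n)%nat ->
    (1 <= M * Cmod (Cpower (INR n) a * INR (fact n) / Cpoch a (S n)))%R.
Proof.
intros Ha; destruct (bigO_pow_nonneg _ _ (binom_bigO a)) as [K [K0 HK]].
set (H := Rpower 2 (Rabs (Re a - 1))).
assert (H0 : (0 < H)%R) by apply Rpower_pos.
assert (Pa := Cmod_ge_0 a).
exists ((K + 1) * H * (Cmod a + 1))%R; split.
{ repeat apply Rmult_lt_0_compat; lra. }
intros n Hn; assert (Pn : (1 <= INR n)%R) by (apply (le_INR 1); lia).
assert (E := f_equal Cmod (gauss_quotient_binom a n Ha Hn)).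
rewrite !Cmod_mult, Cmod_Cpower_pos in E by lra.
set (G := Cmod (Cpower (INR n) a * INR (fact n) / Cpoch a (S n))) in *.
assert (G0 : (0 <= G)%R) by apply Cmod_ge_0.
assert (Hs := Rpower_pos (INR n) (Re a)).
apply Rmult_le_reg_l with (1 := Hs); rewrite Rmult_1_r, <- E at 1.
apply Rle_trans with
  ((K + 1) * (H * Rpower (INR n) (Re a - 1)) * (((Cmod a + 1) * INR n) * G))%R.
- apply Rmult_le_compat; [apply Cmod_ge_0|apply Rmult_le_pos; [apply Cmod_ge_0|easy]| |].
  + apply Rle_trans with (1 := HK n); apply Rmult_le_compat; [easy|left; apply Rpower_pos|lra|].
    now apply Rpower_succ_le.
  + apply Rmult_le_compat_r; [easy|].
    apply Rle_trans with (1 := Cmod_triangle _ _); rewrite Cmod_R, Rabs_pos_eq by lra; nra.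
- right; replace (Re a) with ((Re a - 1) + 1)%R at 2 by ring.
  rewrite Rpower_plus, Rpower_1 by lra; ring.
Qed.

Lemma CGamma_neq_0 (a : C) : (0 < Re a)%R -> CGamma a <> 0.
Proof.
intros Ha E.
destruct (gauss_quotient_lower_bound a Ha) as [M [M0 HM]].
destruct (CGamma_approx a Ha) as [K [K0 HK]].
destruct (nfloor_ex (M * K)) as [N [_ HN]]; [apply Rmult_le_pos; lra|].
assert (H1 := HM (S N) ltac:(lia)); assert (H2 := HK (S N) ltac:(lia)).
rewrite E in H2; unfold Cminus in H2; rewrite Cplus_0_l, Cmod_opp, S_INR in H2.
rewrite S_INR in H1.
assert (P := INR_1_pos N).
apply (Rmult_le_compat_l M) in H2; [|lra].
assert (H3 : (1 <= M * (K / (INR N + 1)))%R) by lra.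
apply (Rmult_le_compat_r (INR N + 1)) in H3; [|lra].
replace (M * (K / (INR N + 1)) * (INR N + 1))%R with (M * K)%R in H3 by (field; lra).
lra.
Qed.

(** With g the Gamma value and G the Gauss quotient, the relative error is (n (g - G) - a G) / ((a +
    n) G). The numerator is bounded since g - G = O(1/n), and the denominator is at least n / M. *)
Lemma binom_asymptotic (a : C) :
  (0 < Re a)%R ->
  exists K : R, (0 <= K)%R /\ forall n : nat, (1 <= n)%nat ->
    (Cmod (binom a n * CGamma a / Cpower (INR n) (a - 1) - 1) <= K / INR n)%R.
Proof.
intros Ha.
destruct (gauss_quotient_lower_bound a Ha) as [M [M0 HM]].
destruct (CGamma_approx a Ha) as [K [K0 HK]].
set (g := CGamma a) in *.
assert (Pa := Cmod_ge_0 a); assert (Pg := Cmod_ge_0 g).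
exists ((K + Cmod a * (Cmod g + K)) * M)%R; split.
{ apply Rmult_le_pos; [|lra]; apply Rplus_le_le_0_compat; [easy|apply Rmult_le_pos; lra]. }
intros n Hn; assert (Pn : (1 <= INR n)%R) by (apply (le_INR 1); lia).
assert (E := gauss_quotient_binom a n Ha Hn); specialize (HM n Hn); specialize (HK n Hn).
set (G := Cpower (INR n) a * INR (fact n) / Cpoch a (S n)) in *.
assert (G0 : G <> 0).
{ intros G0; rewrite G0, Cmod_0 in HM; lra. }
assert (Han : (INR n <= Cmod (a + INR n))%R).
{ apply Rle_trans with (2 := re_le_Cmod _).
  apply Rle_trans with (2 := Rle_abs _); unfold Re in *; simpl; lra. }
assert (Han0 : a + INR n <> 0) by (apply Cmod_gt_0; lra).
assert (Hn0 : RtoC (INR n) <> 0) by (apply RtoC_neq_0; lra).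
replace (binom a n * g / Cpower (INR n) (a - 1) - 1)
  with ((INR n * (g - G) - a * G) / ((a + INR n) * G)).
2: { replace (Cpower (INR n) (a - 1)) with (binom a n * ((a + INR n) * G) / INR n).
     - assert (binom a n <> 0).
       { intros B0; rewrite B0, Cmult_0_l in E; now apply (Cpower_neq_0 (INR n) a). }
       field; repeat split; assumption.
     - rewrite E; replace a with ((a - 1) + 1) at 1 by ring.
       rewrite Cpower_succ by lra; field; exact Hn0. }
rewrite Cmod_div by now apply Cmult_neq_0.
assert (B1 : (Cmod (INR n * (g - G) - a * G) <= K + Cmod a * (Cmod g + K))%R).
{ apply Rle_trans with (1 := Cmod_triangle _ _); rewrite Cmod_opp, !Cmod_mult.
  rewrite Cmod_R, Rabs_pos_eq by lra; apply Rplus_le_compat.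
  - apply Rle_trans with (INR n * (K / INR n))%R.
    + apply Rmult_le_compat_l; lra.
    + right; field; lra.
  - apply Rmult_le_compat_l; [easy|].
    replace G with (g + - (g - G)) by ring.
    apply Rle_trans with (1 := Cmod_triangle _ _); rewrite Cmod_opp.
    apply Rplus_le_compat_l, Rle_trans with (1 := HK).
    apply Rle_div_l; [lra|]; nra. }
assert (GM : (INR n <= M * Cmod ((a + INR n) * G))%R).
{ rewrite Cmod_mult; assert (Q := Cmod_ge_0 G).
  replace (INR n) with (INR n * 1)%R at 1 by ring.
  replace (M * (Cmod (a + INR n) * Cmod G))%R with (Cmod (a + INR n) * (M * Cmod G))%R by ring.
  apply Rmult_le_compat; lra. }
set (X := Cmod (INR n * (g - G) - a * G)) in *.
set (Y := Cmod ((a + INR n) * G)) in *.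
assert (Y0 : (0 < Y)%R) by (unfold Y; now apply Cmod_gt_0, Cmult_neq_0).
apply Rle_div_l; [exact Y0|].
replace ((K + Cmod a * (Cmod g + K)) * M / INR n * Y)%R
  with ((K + Cmod a * (Cmod g + K)) * ((M * Y) / INR n))%R by (field; lra).
apply Rle_trans with ((K + Cmod a * (Cmod g + K)) * 1)%R; [lra|].
apply Rmult_le_compat_l.
- apply Rle_trans with (2 := B1), Cmod_ge_0.
- apply Rle_div_r; lra.
Qed.

Lemma meixner_pollaczek_conv (lambda phi : R) (n : nat) (x : C) :
  meixner_pollaczek lambda phi n x
  = Cexp (Ci * INR n * phi)
    * conv (binomw (Cexp (- (2 * Ci * phi))) (lambda + Ci * x)) (binom (lambda - Ci * x)) n.
Proof.
unfold meixner_pollaczek; f_equal; apply sum_n_ext; intros k.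
unfold binomw, binom; rewrite Cexp_pow.
replace (INR k * - (2 * Ci * phi)) with (- (2 * Ci * INR k * phi)) by ring.
change (Cpoch (lambda + Ci * x) k * Cpoch (lambda - Ci * x) (n - k)
  / (INR (fact k) * INR (fact (n - k))) * Cexp (- (2 * Ci * INR k * phi))
  = Cpoch (lambda + Ci * x) k / INR (fact k) * Cexp (- (2 * Ci * INR k * phi))
    * (Cpoch (lambda - Ci * x) (n - k) / INR (fact (n - k)))).
field; split; apply INR_fact_C_neq_0.
Qed.

Lemma Rpower_neg_lim_0 (d : R) :
  (0 < d)%R -> is_lim_seq (fun n => Rpower (INR n) (- d)) 0.
Proof.
intros Hd; apply is_lim_seq_spec; intros eps; simpl.
destruct (nfloor_ex (Rpower (/ eps) (/ d))) as [N [_ HN]]; [left; apply Rpower_pos|].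
exists (S N); intros n Hn; apply le_INR in Hn; rewrite S_INR in Hn.
rewrite Rminus_0_r, Rabs_pos_eq by (left; apply Rpower_pos).
assert (E := cond_pos eps); assert (P := Rpower_pos (/ eps) (/ d)).
assert (E' : (0 < / eps)%R) by now apply Rinv_0_lt_compat.
rewrite Rpower_Ropp, <- (Rinv_inv eps); apply Rinv_lt_contravar.
- apply Rmult_lt_0_compat; [easy|apply Rpower_pos].
- apply Rle_lt_trans with (Rpower (Rpower (/ eps) (/ d)) d).
  + rewrite Rpower_mult, Rinv_l, Rpower_1; lra.
  + apply Rlt_Rpower_l; lra.
Qed.

Theorem mainTheorem7 (lambda phi : R) (x : C)
    (hlambda : (0 < lambda)%R) (hphi : (0 < phi < PI)%R) (hx : (0 < Im x)%R) :
  filterlim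
    (fun n : nat =>
       meixner_pollaczek lambda phi n x
       / (Cpower (INR n) (lambda - Ci * x - 1) / CGamma (lambda - Ci * x)
          * Cexp (Ci * INR n * phi)
          * Cpower (1 - Cexp (- (2 * Ci * phi))) (- lambda - Ci * x)))
    eventually (locally (T := C_UniformSpace) (RtoC 1)).
Proof.
set (w := Cexp (- (2 * Ci * phi))).
set (a := lambda - Ci * x); set (b := lambda + Ci * x).
assert (Ea : Re a = (lambda + Im x)%R) by (unfold a, Re, Im; simpl; ring).
assert (Eb : Re b = (lambda - Im x)%R) by (unfold b, Re, Im; simpl; ring).
replace (- lambda - Ci * x) with (- b) by (unfold b; ring).
assert (Hw : Cmod w = 1%R).
{ unfold w; rewrite Cmod_Cexp, <- exp_0; f_equal; unfold Re; simpl; ring. }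
(* Re w = cos (2 phi) = 1 - 2 sin(phi)^2, and sin phi > 0 on (0, PI). *)
assert (Hw1 : (Re w < 1)%R).
{ replace (Re w) with (cos (2 * phi)).
  - rewrite cos_2a_sin; assert (S := sin_gt_0 phi (proj1 hphi) (proj2 hphi)); nra.
  - unfold w; replace (- (2 * Ci * phi)) with (0%R, (- (2 * phi))%R)
      by (apply injective_projections; simpl; ring).
    unfold Cexp, Re, Im; simpl; now rewrite exp_0, cos_neg, Rmult_1_l. }
set (L := Cpower (1 - w) (- b)).
assert (L0 : L <> 0) by apply Cpower_neq_0.
assert (Ha : (0 < Re a)%R) by lra.
assert (g0 := CGamma_neq_0 a Ha); set (g := CGamma a) in *.
(* The largest gain that [conv_binom_error] permits: d <= 1 gives Re a - 2 <= s, and d <= Re a - Re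
   b = 2 Im x gives Re b - 1 <= s. *)
set (d := Rmin 1 (Re a - Re b)); set (s := (Re a - 1 - d)%R).
assert (Hd : (0 < d)%R) by (apply Rmin_glb_lt; lra).
assert (Hd1 := Rmin_l 1 (Re a - Re b)); fold d in Hd1.
assert (Hd2 := Rmin_r 1 (Re a - Re b)); fold d in Hd2.
destruct (bigO_pow_nonneg _ _ (conv_binom_error w a b s Hw Hw1 ltac:(unfold s; lra) ltac:(unfold s; lra)))
  as [K [K0 HK]]; fold L in HK.
destruct (binom_asymptotic a Ha) as [K' [K0' HK']]; fold g in HK'.
set (M := (K' + K * Rpower 2 (Rabs s) * Cmod g / Cmod L)%R).
assert (bound : forall n : nat, (1 <= n)%nat ->
  (Cmod (meixner_pollaczek lambda phi n x
     / (Cpower (INR n) (a - 1) / g * Cexp (Ci * INR n * phi) * L) - 1)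
   <= M * Rpower (INR n) (- d))%R).
{ intros n Hn; assert (Pn : (1 <= INR n)%R) by (apply (le_INR 1); lia).
  rewrite meixner_pollaczek_conv; fold a b w.
  set (N := Cpower (INR n) (a - 1)).
  assert (N0 : N <> 0) by apply Cpower_neq_0.
  assert (e0 := Cexp_neq_0 (Ci * INR n * phi)).
  specialize (HK n); specialize (HK' n Hn); fold N in HK'.
  set (S := conv (binomw w b) (binom a) n) in *.
  (* The first summand is Gauss's relative error O(1/n), the second the coefficient error of order
     n^s over a main term of order n^(Re a - 1). As d <= 1, both are O(n^(-d)). *)
  replace (Cexp (Ci * INR n * phi) * S / (N / g * Cexp (Ci * INR n * phi) * L) - 1)
    with ((binom a n * g / N - 1) + (S - L * binom a n) * g / (N * L))
    by (field; repeat split; assumption).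
  apply Rle_trans with (1 := Cmod_triangle _ _); unfold M; rewrite Rmult_plus_distr_r.
  apply Rplus_le_compat.
  - apply Rle_trans with (1 := HK'); apply Rmult_le_compat_l; [easy|].
    rewrite <- (Rpower_1 (INR n)) at 1 by lra; rewrite <- Rpower_Ropp.
    apply Rle_Rpower; lra.
  - rewrite Cmod_div by now apply Cmult_neq_0.
    rewrite !Cmod_mult; unfold N; rewrite Cmod_Cpower_pos by lra.
    assert (PL := proj1 (Cmod_gt_0 L) L0); assert (PN := Rpower_pos (INR n) (Re (a - 1))).
    apply Rle_div_l; [now apply Rmult_lt_0_compat|].
    replace (Re (a - 1)) with (Re a - 1)%R by (unfold Re; simpl; ring).
    replace (K * Rpower 2 (Rabs s) * Cmod g / Cmod L * Rpower (INR n) (- d)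
             * (Rpower (INR n) (Re a - 1) * Cmod L))%R
      with (K * (Rpower 2 (Rabs s) * (Rpower (INR n) (Re a - 1) * Rpower (INR n) (- d))) * Cmod g)%R
      by (field; lra).
    rewrite <- Rpower_plus; fold s.
    apply Rmult_le_compat_r; [apply Cmod_ge_0|].
    apply Rle_trans with (1 := HK); apply Rmult_le_compat_l; [easy|].
    apply Rpower_succ_le; lra. }
assert (Lim : is_lim_seq (fun n => M * Rpower (INR n) (- d))%R 0).
{ replace (Finite 0) with (Rbar_mult M 0) by (simpl; f_equal; ring).
  apply is_lim_seq_scal_l; now apply Rpower_neg_lim_0. }
apply is_lim_seq_spec in Lim; simpl in Lim.
intros P [eps HP]; destruct (Lim eps) as [N HN].
exists (Datatypes.S N); intros n Hn; apply HP, C_NormedModule_mixin_compat1.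
apply Rle_lt_trans with (1 := bound n ltac:(lia)).
apply Rle_lt_trans with (1 := Rle_abs _).
specialize (HN n ltac:(lia)); now rewrite Rminus_0_r in HN.
Qed.
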